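(* Fix positive integers $c$ and $k$. There is an algorithm which, given an NU default theory $\Delta=(D,W)$ of tightness at most $c$ (i.e. a $c$-quasi-acyclic NU theory), enumerates all strong outlier sets $L$ in $\Delta$ with $|L|\le k$, in time polynomial in the size of $(D,W)$.
   Context: For a set of formulas $T$, $T^*$ is its logical closure; $\neg\neg a=a$ for a letter $a$. A normal unary (NU) default theory is a pair $(D,W)$ with $W$ a finite consistent set of propositional literals and $D$ a finite set of defaults $\frac{\alpha:\beta}{\beta}$, where $\beta$ is a single literal and the prerequisite $\alpha$ is empty or a single positive literal. A set $\mathcal E$ is an extension of $(D,W)$ if $\mathcal E=\bigcup_{i\ge0}E_i$, where $E_0=W$ and $E_{i+1}=E_i^*\cup\{\beta \mid \frac{\alpha:\beta}{\beta}\in D,\ \alpha\in E_i \text{ (or } \alpha \text{ empty)},\ \neg\beta\notin\mathcal E\}$. $(D,W)\models\phi$ means $\phi$ belongs to every extension of $(D,W)$. The atomic dependency graph of the theory is the directed graph whose vertices are the letters occurring in it, with an edge $(x,y)$ whenever letters $x$ and $y$ occur respectively in the prerequisite and the consequent of some default in $D$. The tightness is the number of letters in the largest strongly connected component of this graph. Strong outliers: a set of literals $L\subset W$ is a strong outlier set in $\Delta=(D,W)$, with strong outlier witness set $S$, if $S$ is a non-empty subset of $W\setminus L$ such that (1) for all $\ell\in S$, $(D,W\setminus S)\models\neg\ell$, and (2) for all $\ell\in S$, $(D,W\setminus(S\cup L))\not\models\neg\ell$. *)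

(* Defs.v *)
From HB Require Import structures.
From mathcomp Require Import all_boot all_algebra finmap.

Set Implicit Arguments.
Unset Strict Implicit.
Unset Printing Implicit Defensive.

Local Open Scope fset_scope.
Local Open Scope nat_scope.

(* Letters are named by arbitrary bit strings, so that the length of a theory *)
(* accounts for the length of the names occurring in it.                      *)
Definition letter := seq bool.

(* (true, a) is the literal a, and (false, a) is the literal ~ a. *)
Definition literal := (bool * letter)%type.

Definition lneg (l : literal) : literal := (~~ l.1, l.2).

Inductive formula :=
| FVar of letter
| FFalse
| FNot of formula
| FAnd of formula & formula
| FOr of formula & formula.

Definition lit_formula (l : literal) : formula :=
  if l.1 then FVar l.2 else FNot (FVar l.2).

Fixpoint sat (v : letter -> bool) (f : formula) : bool :=
  match f with
  | FVar a => v a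
  | FFalse => false
  | FNot f1 => ~~ sat v f1
  | FAnd f1 f2 => sat v f1 && sat v f2
  | FOr f1 f2 => sat v f1 || sat v f2
  end.

Definition logical_closure (T : formula -> Prop) : formula -> Prop :=
  fun f => forall v, (forall g, T g -> sat v g) -> sat v f.

Definition lits (W : {fset literal}) : formula -> Prop :=
  fun f => exists2 l, l \in W & f = lit_formula l.

Definition consistent (W : {fset literal}) : Prop :=
  ~ logical_closure (lits W) FFalse.

(* (o, b) is the normal default o : b / b, whose prerequisite is empty when o *)
(* is None, and is the positive literal a when o is Some a.                   *)
Definition default := (option letter * literal)%type.

Definition prereq_in (o : option letter) (E : formula -> Prop) : Prop :=
  if o is Some a then E (FVar a) else True.

Fixpoint stage (D : {fset default}) (W : {fset literal})
    (E : formula -> Prop) (i : nat) : formula -> Prop :=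
  if i is i'.+1 then
    fun f => logical_closure (stage D W E i') f \/
      exists d, [/\ d \in D, prereq_in d.1 (stage D W E i'),
                    ~ E (lit_formula (lneg d.2)) & f = lit_formula d.2]
  else lits W.

Definition extension (D : {fset default}) (W : {fset literal})
    (E : formula -> Prop) : Prop :=
  forall f, E f <-> exists i, stage D W E i f.

Definition entails (D : {fset default}) (W : {fset literal})
    (f : formula) : Prop :=
  forall E, extension D W E -> E f.

Definition strong_witness (D : {fset default}) (W L S : {fset literal}) :
    Prop :=
  [/\ S != fset0,
      S `<=` W `\` L,
      forall l, l \in S -> entails D (W `\` S) (lit_formula (lneg l)) &
      forall l, l \in S ->
        ~ entails D (W `\` (S `|` L)) (lit_formula (lneg l))].

Definition strong_outlier_set (D : {fset default}) (W L : {fset literal}) :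
    Prop :=
  L `<=` W /\ exists S, strong_witness D W L S.

Definition default_letters (d : default) : seq letter :=
  d.2.2 :: (if d.1 is Some a then [:: a] else [::]).

Definition letters (D : {fset default}) (W : {fset literal}) : {fset letter} :=
  [fset a in flatten [seq default_letters d | d <- D] ++ [seq l.2 | l <- W]].

Definition dep_edge (D : {fset default}) (W : {fset literal}) :
    rel (letters D W) :=
  fun x y => has (fun d : default => (d.1 == Some (val x)) && (d.2.2 == val y)) D.

Definition scc (D : {fset default}) (W : {fset literal}) (x : letters D W) :
    {set letters D W} :=
  [set y | connect (@dep_edge D W) x y && connect (@dep_edge D W) y x].

Definition tightness (D : {fset default}) (W : {fset literal}) : nat :=
  \max_(x : letters D W) #|scc x|.

(* The model of computation is Jones's WHILE language over binary trees.      *)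
(* Evaluating an expression is charged the size of the value of each of its   *)
(* subexpressions, as if values were copied and never shared: the running     *)
(* time is then polynomially related to that of a Turing machine.             *)
Inductive tree := Leaf | Node of tree & tree.

Fixpoint tree_size (t : tree) : nat :=
  if t is Node t1 t2 then (tree_size t1 + tree_size t2).+1 else 1.

Definition store := nat -> tree.

Definition upd (s : store) (x : nat) (t : tree) : store :=
  fun y => if y == x then t else s y.

Inductive expr :=
| EVar of nat
| ENil
| ECons of expr & expr
| EHd of expr
| ETl of expr.

Fixpoint eval (s : store) (e : expr) : tree :=
  match e with
  | EVar x => s x
  | ENil => Leaf
  | ECons e1 e2 => Node (eval s e1) (eval s e2)
  | EHd e1 => if eval s e1 is Node t _ then t else Leaf
  | ETl e1 => if eval s e1 is Node _ t then t else Leaf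
  end.

Fixpoint ecost (s : store) (e : expr) : nat :=
  tree_size (eval s e) +
  match e with
  | EVar _ | ENil => 0
  | ECons e1 e2 => ecost s e1 + ecost s e2
  | EHd e1 | ETl e1 => ecost s e1
  end.

Inductive cmd :=
| CAssign of nat & expr
| CSeq of cmd & cmd
| CIf of expr & cmd & cmd
| CWhile of expr & cmd.

(* exec p s s' t: started in store s, p halts in store s' in time t.  A test  *)
(* succeeds when its value is not Leaf.                                       *)
Inductive exec : cmd -> store -> store -> nat -> Prop :=
| ExAssign s x e :
    exec (CAssign x e) s (upd s x (eval s e)) (ecost s e).+1
| ExSeq p q s s1 s2 t1 t2 :
    exec p s s1 t1 -> exec q s1 s2 t2 ->
    exec (CSeq p q) s s2 (t1 + t2).+1
| ExIfTrue e p q s s' t :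
    eval s e <> Leaf -> exec p s s' t ->
    exec (CIf e p q) s s' (ecost s e + t).+1
| ExIfFalse e p q s s' t :
    eval s e = Leaf -> exec q s s' t ->
    exec (CIf e p q) s s' (ecost s e + t).+1
| ExWhileTrue e p s s1 s2 t1 t2 :
    eval s e <> Leaf -> exec p s s1 t1 -> exec (CWhile e p) s1 s2 t2 ->
    exec (CWhile e p) s s2 (ecost s e + t1 + t2).+1
| ExWhileFalse e p s :
    eval s e = Leaf -> exec (CWhile e p) s s (ecost s e).+1.

(* Input and output are passed in variable 0. *)
Definition computes (p : cmd) (input output : tree) (t : nat) : Prop :=
  exists2 s, exec p (upd (fun=> Leaf) 0 input) s t & s 0 = output.

Definition enc_bool (b : bool) : tree := if b then Node Leaf Leaf else Leaf.

Definition enc_seq (T : Type) (enc : T -> tree) (s : seq T) : tree :=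
  foldr (fun x t => Node (enc x) t) Leaf s.

Definition enc_letter (a : letter) : tree := enc_seq enc_bool a.

Definition enc_literal (l : literal) : tree :=
  Node (enc_bool l.1) (enc_letter l.2).

Definition enc_default (d : default) : tree :=
  Node (if d.1 is Some a then Node (enc_letter a) Leaf else Leaf)
       (enc_literal d.2).

Definition enc_theory (ds : seq default) (ws : seq literal) : tree :=
  Node (enc_seq enc_default ds) (enc_seq enc_literal ws).

Definition enc_literal_sets (out : seq (seq literal)) : tree :=
  enc_seq (enc_seq enc_literal) out.

(* out lists, each exactly once, the finite sets satisfying P, each of them   *)
(* being given by a duplicate-free list of its elements.                      *)
Definition enumerates (P : {fset literal} -> Prop) (out : seq (seq literal)) :
    Prop :=
  exists Ls : seq {fset literal},
    [/\ uniq Ls,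
        forall L, L \in Ls <-> P L &
        all2 (fun l (L : {fset literal}) => perm_eq l L) out Ls].

(* Main.v *)
(* An extension is determined by the set T of the letters that it makes true.  *)
(* The sets that arise, called stable below, contain the letters asserted by W *)
(* and none of those denied by W; a default that T triggers has a conclusion   *)
(* in T unless the opposite literal is supported; and no nonempty subset of T  *)
(* is unfounded.  Since prerequisites are positive and single, stable sets     *)
(* that avoid given letters are closed under union, so nested greatest         *)
(* fixpoints find the largest one, and skeptical entailment of a literal is    *)
(* decided in polynomial time.                                                 *)
(*   Entailment of a literal only depends on the ancestors of its letter in    *)
(* the dependency graph.  Hence the part of a witness set S in a strongly      *)
(* connected component that is minimal among those meeting S is again a        *)
(* witness set, and it has at most c elements.  It remains to try all L and S  *)
(* with at most k and c elements.                                              *)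
(*   For the running time, functions between encoded types are shown to be     *)
(* polynomial-time by closure properties; the only loop is a left fold whose   *)
(* accumulator has polynomially bounded size.                                  *)
Require Import Defs.
From mathcomp Require Import all_boot all_algebra finmap.
From mathcomp Require Import zify boolp.

Set Implicit Arguments.
Unset Strict Implicit.
Unset Printing Implicit Defensive.

Local Open Scope fset_scope.
Local Open Scope nat_scope.

(** Semantics. An extension is fixed by the letters it contains: [extension_stable] and
    [stable_extension] match extensions with [stable] sets, and a negative literal belongs to the
    extension exactly when it is supported and its letter is absent ([holds]).

    Entailment. A prerequisite is at most one positive letter, so whatever justifies a letter in a
    stable set still justifies it in every larger set. Hence pruning unjustified letters never
    removes a letter of a stable set that avoids [A], and what remains is itself stable as soon as
    one such set exists ([stable_avoidable], [largest_avoiding_stable]). [entailsbP] reduces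
    skeptical entailment of a literal to tests on these largest sets.

    Small witnesses. By [entails_local], entailment of a literal ignores all literals of [W] over
    non-ancestors of its letter. [small_witness] chooses a letter of [S] with fewest ancestors and
    keeps only the literals over its ancestors: their letters lie in one strongly connected
    component, so at most [c] literals remain.

    Complexity. For fixed [c] and [k] the candidate pairs are polynomially many ([poly_words]), and
    testing them all gives the enumeration ([outliers_enumerates]). The class [poly_time] is closed
    under composition, pairing, branching and left folds with bounded accumulator ([poly_foldl]), so
    [poly_outliers] follows the structure of the algorithm. *)

Lemma horner_nat_mono (q : {poly nat}) (m n : nat) :
  m <= n -> q.[m]%R <= q.[n]%R.
Proof.
move=> le_mn; rewrite !horner_coef.
elim/big_ind2: _ => // [x1 x2 y1 y2|i _]; first exact: leq_add.
rewrite leq_mul2l; apply/orP; right; elim: (i : nat) => // j IHj.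
by rewrite !GRing.exprS; apply: leq_mul.
Qed.

(** * Cost functions bounded by polynomials, and growth of stores *)

Definition polybound (b : nat -> nat) : Prop :=
  exists q : {poly nat}, forall n, b n <= q.[n]%R.

Lemma polybound_const (m : nat) : polybound (fun=> m).
Proof. by exists (m%:P)%R => n; rewrite hornerC. Qed.

Lemma polybound_id : polybound id.
Proof. by exists 'X%R => n; rewrite hornerX. Qed.

Lemma polybound_horner (q : {poly nat}) : polybound (fun n => q.[n]%R).
Proof. by exists q. Qed.

Lemma polybound_add (b1 b2 : nat -> nat) :
  polybound b1 -> polybound b2 -> polybound (fun n => b1 n + b2 n).
Proof.
move=> [q1 h1] [q2 h2]; exists (q1 + q2)%R => n.
by rewrite hornerD leq_add.
Qed.

Lemma polybound_mul (b1 b2 : nat -> nat) :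
  polybound b1 -> polybound b2 -> polybound (fun n => b1 n * b2 n).
Proof.
move=> [q1 h1] [q2 h2]; exists (q1 * q2)%R => n.
by rewrite hornerM leq_mul.
Qed.

Lemma polybound_comp (q : {poly nat}) (b : nat -> nat) :
  polybound b -> polybound (fun n => q.[b n]%R).
Proof.
move=> [q1 h1]; exists (q \Po q1)%R => n.
by rewrite horner_comp; apply: horner_nat_mono.
Qed.

Ltac polybound_tac :=
  repeat first [ exact: polybound_const | exact: polybound_id
               | exact: polybound_horner
               | apply: polybound_add | apply: polybound_mul
               | apply: polybound_comp ].

Lemma size_eval_le s e : tree_size (eval s e) <= ecost s e.
Proof. by case: e => *; apply: leq_addr. Qed.

(** Every assignment is charged at least the size of the value that it stores. *)
Lemma exec_size p s s' t x :
  exec p s s' t -> tree_size (s' x) <= tree_size (s x) + t.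
Proof.
move=> h; elim: h x => {p s s' t}.
- move=> s x e y; rewrite /upd; case: eqP => _; last exact: leq_addr.
  by have := size_eval_le s e; lia.
- by move=> p q s s1 s2 t1 t2 _ IH1 _ IH2 x; have:= IH1 x; have := IH2 x; lia.
- by move=> e p q s s' t _ _ IH x; have := IH x; lia.
- by move=> e p q s s' t _ _ IH x; have := IH x; lia.
- move=> e p s s1 s2 t1 t2 _ _ IH1 _ IH2 x.
  by have:= IH1 x; have := IH2 x; lia.
- by move=> *; lia.
Qed.

(** * Polynomial-time functions *)

Class Enc (A : Type) := enc : A -> tree.

#[export] Instance Enc_bool : Enc bool := enc_bool.
#[export] Instance Enc_unit : Enc unit := fun=> Leaf.
#[export] Instance Enc_pair A B (eA : Enc A) (eB : Enc B) : Enc (A * B) :=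
  fun x => Node (enc x.1) (enc x.2).
#[export] Instance Enc_seq A (eA : Enc A) : Enc (seq A) := enc_seq enc.
#[export] Instance Enc_option A (eA : Enc A) : Enc (option A) :=
  fun o => if o is Some a then Node (enc a) Leaf else Leaf.
#[export] Instance Enc_letter : Enc letter := Enc_seq Enc_bool.
#[export] Instance Enc_literal : Enc literal :=
  Enc_pair Enc_bool Enc_letter.
#[export] Instance Enc_default : Enc default :=
  Enc_pair (Enc_option Enc_letter) Enc_literal.

(* The program may start in any store, which makes programs composable: data  *)
(* is saved across a call in variables beyond those that the callee modifies. *)
Definition poly_time A B {eA : Enc A} {eB : Enc B} (f : A -> B) : Prop :=
  exists (p : cmd) (N : nat) (q : {poly nat}), forall (s : store) (a : A),
    s 0 = enc a -> exists s' t,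
      [/\ exec p s s' t, s' 0 = enc (f a), forall y, N <= y -> s' y = s y
        & t <= q.[tree_size (enc a)]%R].

Lemma poly_time_intro A B (eA : Enc A) (eB : Enc B) (f : A -> B)
    (p : cmd) (N : nat) (b : nat -> nat) :
  polybound b ->
  (forall (s : store) (a : A), s 0 = enc a -> exists s' t,
      [/\ exec p s s' t, s' 0 = enc (f a), forall y, N <= y -> s' y = s y
        & t <= b (tree_size (enc a))]) -> poly_time f.
Proof.
move=> [q hq] h; exists p, N, q => s a /h [s' [t [h1 h2 h3 h4]]].
by exists s', t; split=> //; apply: leq_trans h4 (hq _).
Qed.

(** By [exec_size], the output is no larger than input plus running time. This bounds the input of
    the second program in a composition. *)
Lemma poly_size A B (eA : Enc A) (eB : Enc B) (f : A -> B) :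
  poly_time f ->
  exists q : {poly nat}, forall a, tree_size (enc (f a)) <= q.[tree_size (enc a)]%R.
Proof.
move=> [p [N [q h]]]; exists ('X + q)%R => a.
have [//|s' [t [h1 h2 _ h4]]] := h (fun=> enc a) a.
rewrite hornerD hornerX -h2.
by apply: leq_trans (exec_size 0 h1) _; rewrite leq_add2l.
Qed.

Lemma poly_ext A B (eA : Enc A) (eB : Enc B) (f g : A -> B) :
  f =1 g -> poly_time f -> poly_time g.
Proof.
move=> fg [p [N [q h]]]; exists p, N, q => s a /h [s' [t H]].
by exists s', t; rewrite -fg.
Qed.

(** Covers the functions that only change the type under which a tree is read, such as consing a
    pair or viewing an option as a list. *)
Lemma poly_recode A B (eA : Enc A) (eB : Enc B) (f : A -> B) :
  (forall a, enc (f a) = enc a) -> poly_time f.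
Proof.
move=> h; apply: (@poly_time_intro _ _ _ _ _ (CAssign 0 (EVar 0)) 1
    (fun n => n + 0 + 1)); first polybound_tac.
move=> s a sa; exists (upd s 0 (s 0)), ((tree_size (s 0) + 0).+1); split.
- exact: (ExAssign s 0 (EVar 0)).
- by rewrite /upd eqxx h.
- by move=> y; rewrite /upd; case: eqP => // ->.
- by rewrite sa; lia.
Qed.

Lemma poly_id A (eA : Enc A) : poly_time (fun a : A => a).
Proof. exact: poly_recode. Qed.

Lemma poly_comp A B C (eA : Enc A) (eB : Enc B) (eC : Enc C)
    (g : B -> C) (f : A -> B) :
  poly_time g -> poly_time f -> poly_time (fun a => g (f a)).
Proof.
move=> [p2 [N2 [q2 h2]]] pf; have [qs hs] := poly_size pf.
have [p1 [N1 [q1 h1]]] := pf.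
apply: (@poly_time_intro _ _ _ _ _ (CSeq p1 p2) (maxn N1 N2)
  (fun n => q1.[n]%R + q2.[qs.[n]%R]%R + 1)).
  by polybound_tac.
move=> s a sa; have [s1 [t1 [e1 r1 f1 c1]]] := h1 s a sa.
have [s2 [t2 [e2 r2 f2 c2]]] := h2 s1 _ r1.
exists s2, (t1 + t2).+1; split.
- exact: ExSeq e1 e2.
- by [].
- by move=> y; rewrite geq_max => /andP [/f1 <- /f2 ->].
- rewrite -addn1 leq_add2r leq_add //.
  by apply: leq_trans c2 _; apply: horner_nat_mono.
Qed.

Lemma poly_const A B (eA : Enc A) (eB : Enc B) (b : B) :
  poly_time (fun _ : A => b).
Proof.
have [e [c he]] : exists e c, forall s, eval s e = enc b /\ ecost s e = c.
  elim: (enc b) => [|t1 [e1 [c1 h1]] t2 [e2 [c2 h2]]]; first by exists ENil, 1.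
  exists (ECons e1 e2), (tree_size (Node t1 t2) + (c1 + c2)) => s /=.
  by have [-> ->] := h1 s; have [-> ->] := h2 s.
apply: (@poly_time_intro _ _ _ _ _ (CAssign 0 e) 1 (fun=> c.+1)).
  exact: polybound_const.
move=> s a sa; have [h1 h2] := he s.
exists (upd s 0 (eval s e)), (ecost s e).+1; split.
- exact: ExAssign.
- by rewrite /upd eqxx h1.
- by move=> y; rewrite /upd; case: eqP => // ->.
- by rewrite h2.
Qed.

Lemma poly_fst A B (eA : Enc A) (eB : Enc B) : poly_time (fun x : A * B => x.1).
Proof.
apply: (@poly_time_intro _ _ _ _ _ (CAssign 0 (EHd (EVar 0))) 1
  (fun n => n + n + 1)); first polybound_tac.
move=> s a sa; exists (upd s 0 (eval s (EHd (EVar 0)))),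
  (ecost s (EHd (EVar 0))).+1; split.
- exact: ExAssign.
- by rewrite /upd /= sa.
- by move=> y; rewrite /upd; case: eqP => // ->.
- by rewrite /= sa /=; lia.
Qed.

Lemma poly_snd A B (eA : Enc A) (eB : Enc B) : poly_time (fun x : A * B => x.2).
Proof.
apply: (@poly_time_intro _ _ _ _ _ (CAssign 0 (ETl (EVar 0))) 1
  (fun n => n + n + 1)); first polybound_tac.
move=> s a sa; exists (upd s 0 (eval s (ETl (EVar 0)))),
  (ecost s (ETl (EVar 0))).+1; split.
- exact: ExAssign.
- by rewrite /upd /= sa.
- by move=> y; rewrite /upd; case: eqP => // ->.
- by rewrite /= sa /=; lia.
Qed.

Lemma poly_pair A B C (eA : Enc A) (eB : Enc B) (eC : Enc C)
    (f : A -> B) (g : A -> C) :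
  poly_time f -> poly_time g -> poly_time (fun a => (f a, g a)).
Proof.
move=> pf pg; have [qf hf] := poly_size pf; have [qg hg] := poly_size pg.
have [p1 [N1 [q1 h1]]] := pf; have [p2 [N2 [q2 h2]]] := pg.
(* Registers [N] and [N.+1] differ from 0 and lie beyond those of both callees; they keep the input
   and the first result. *)
pose N := (maxn N1 N2).+1.
apply: (@poly_time_intro _ _ _ _ _
  (CSeq (CAssign N (EVar 0))
  (CSeq p1
  (CSeq (CAssign N.+1 (EVar 0))
  (CSeq (CAssign 0 (EVar N))
  (CSeq p2 (CAssign 0 (ECons (EVar N.+1) (EVar 0))))))))
  N.+2
  (fun n => (n + n + q1.[n]%R + q2.[n]%R) + (qf.[n]%R + qf.[n]%R + qf.[n]%R) +
     (qg.[n]%R + qg.[n]%R) + 100)).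
  by polybound_tac.
move=> s a sa.
pose s0 := upd s N (s 0).
have [|s1 [t1 [e1 r1 f1 c1]]] := h1 s0 a; first by rewrite /s0 /upd.
pose s2 := upd s1 N.+1 (s1 0); pose s3 := upd s2 0 (s2 N).
have s1N : s1 N = enc a.
  by rewrite f1 ?/s0 ?/upd ?eqxx //; lia.
have s3N : s3 0 = enc a.
  by rewrite /s3 /upd /= /s2 /upd ltn_eqF.
have [s4 [t4 [e4 r4 f4 c4]]] := h2 s3 a s3N.
have s4N : s4 N.+1 = enc (f a).
  rewrite f4; last by lia.
  by rewrite /s3 /upd /= /s2 /upd eqxx.
eexists (upd s4 0 _), _; split.
- apply: ExSeq; first exact: ExAssign.
  apply: ExSeq; first exact: e1.
  apply: ExSeq; first exact: ExAssign.
  apply: ExSeq; first exact: ExAssign.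
  apply: ExSeq; first exact: e4.
  exact: ExAssign.
- by rewrite /upd /= s4N r4.
- move=> y Ny; rewrite /upd; case: eqP => [|_]; first by lia.
  rewrite f4; last by lia.
  rewrite /s3 /upd; case: eqP => [|_]; first by lia.
  rewrite /s2 /upd; case: eqP => [|_]; first by lia.
  rewrite f1; last by lia.
  by rewrite /s0 /upd; case: eqP => //; lia.
- rewrite /= s4N r4 /= -/s2 r1 {1}/s2 /upd (ltn_eqF (ltnSn N)) s1N sa.
  by have := hf a; have := hg a; lia.
Qed.

(* The value of [l] is split in place: [enc (x :: s) = enc (x, s)].           *)
Lemma poly_match A B C (eA : Enc A) (eB : Enc B) (eC : Enc C)
    (l : A -> seq B) (f : A -> B -> seq B -> C) (g : A -> C) :
  poly_time l -> poly_time (fun p : A * (B * seq B) => f p.1 p.2.1 p.2.2) ->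
  poly_time g ->
  poly_time (fun a => if l a is x :: s then f a x s else g a).
Proof.
move=> pl pf pg; have {}pl := poly_pair (poly_id eA) pl.
suff h : @poly_time _ _ (Enc_pair eA (Enc_seq eB)) eC (fun p : A * seq B => if p.2 is x :: s then f p.1 x s else g p.1).
  exact (poly_comp h pl).
have [p1 [N1 [q1 h1]]] := pf; have [p2 [N2 [q2 h2]]] := pg.
apply: (@poly_time_intro _ _ _ _ _
  (CIf (ETl (EVar 0)) p1 (CSeq (CAssign 0 (EHd (EVar 0))) p2)) (maxn 1 (maxn N1 N2))
  (fun n => q1.[n]%R + q2.[n]%R + (n + n + n + n + n) + 100)).
  by polybound_tac.
move=> s [a [|x r]] sa; rewrite /= ?sa.
- pose s0 := upd s 0 (@enc A eA a).
  have [|s1 [t1 [e1 r1 f1 c1]]] := h2 s0 a; first by rewrite /s0 /upd.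
  exists s1; eexists; split.
  + apply: ExIfFalse; first by rewrite /= sa.
    apply: ExSeq; first exact: ExAssign.
    by rewrite /= sa; exact: e1.
  + by rewrite r1.
  + move=> y hy; rewrite f1; last by lia.
    by rewrite /s0 /upd; case: eqP => //; lia.
  + move: c1; rewrite /= sa /enc /= => c1.
    have := leq_trans c1 (horner_nat_mono q2 (leqW (leq_addr 1 _))).
    by rewrite /enc; lia.
- have [|s1 [t1 [e1 r1 f1 c1]]] := h1 s (a, (x, r)); first by rewrite sa.
  exists s1; eexists; split.
  + by apply: ExIfTrue; [rewrite /= sa | exact: e1].
  + by rewrite r1.
  + by move=> y hy; rewrite f1 //; lia.
  + by move: c1; rewrite /= sa /= /enc /=; lia.
Qed.

Lemma size_enc_take A (eA : Enc A) (l : seq A) i :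
  tree_size (enc (take i l)) <= tree_size (enc l).
Proof.
elim: l i => [|x l IHl] [|i] //=.
by have := IHl i; rewrite /enc /= /enc; lia.
Qed.

Lemma size_enc_seq A (eA : Enc A) (l : seq A) : size l < tree_size (enc l).
Proof. by elim: l => [|x l IHl] //=; move: IHl; rewrite /enc /=; lia. Qed.

(** * Left folds with bounded accumulator *)

Section Fold.

Variables (G A B : Type) (eG : Enc G) (eA : Enc A) (eB : Enc B).
Variable F : G -> B -> A -> B.
Variables (pF : cmd) (N : nat) (q : {poly nat}).
Hypothesis N_gt0 : 0 < N.
Hypothesis pFP : forall (s : store) (a : G * B * A),
  s 0 = enc a -> exists s' t,
    [/\ exec pF s s' t, s' 0 = enc (F a.1.1 a.1.2 a.2),
        forall y, N <= y -> s' y = s y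
      & t <= q.[tree_size (enc a)]%R].

(** Register [N] holds the context, [N.+1] the rest of the list, [N.+2] the accumulator; [pF]
    modifies only registers below [N]. *)
Definition fold_loop : cmd :=
  CWhile (EVar N.+1)
    (CSeq (CAssign 0 (ECons (ECons (EVar N) (EVar N.+2)) (EHd (EVar N.+1))))
    (CSeq pF
    (CSeq (CAssign N.+2 (EVar 0)) (CAssign N.+1 (ETl (EVar N.+1)))))).

Lemma fold_loopP (g : G) (M : nat) (l : seq A) (b : B) (s : store) :
  s N = enc g -> s N.+1 = enc l -> s N.+2 = enc b ->
  tree_size (enc g) <= M -> tree_size (enc l) <= M ->
  (forall i, tree_size (enc (foldl (F g) b (take i l))) <= M) ->
  exists s' t,
    [/\ exec fold_loop s s' t, s' N.+2 = enc (foldl (F g) b l),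
        forall y, N.+3 <= y -> s' y = s y
      & t <= (size l).+1 * (q.[3 * M + 2]%R + 20 * M + 20)].
Proof.
move=> + + + gM; elim: l b s => [|x l IHl] b s sg sl sb lM bM.
  exists s, (ecost s (EVar N.+1)).+1; split=> //.
    exact: ExWhileFalse.
  by rewrite /= sl /=; lia.
have := bM 1; rewrite /= take0 /= => b1M; have b0M := bM 0.
rewrite /= in b0M.
pose s0 := upd s 0 (eval s (ECons (ECons (EVar N) (EVar N.+2)) (EHd (EVar N.+1)))).
have xl : tree_size (enc (x :: l)) = (tree_size (enc x) + tree_size (enc l)).+1.
  by [].
have [|s1 [t1 [e1 r1 f1 c1]]] := @pFP s0 (g, b, x).
  by rewrite /s0 /upd /= sg sb sl.
pose s2 := upd s1 N.+2 (s1 0).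
pose s3 := upd s2 N.+1 (eval s2 (ETl (EVar N.+1))).
have s2l : s2 N.+1 = enc (x :: l).
  by rewrite /s2 /upd ltn_eqF // f1.
have [|||||s4 [t4 [e4 r4 f4 c4]]] := IHl (F g b x) s3.
- rewrite /s3 /upd ltn_eqF // /s2 /upd ltn_eqF; last by lia.
  by rewrite f1 // /s0 /upd gtn_eqF.
- by rewrite /s3 /upd eqxx /= s2l.
- rewrite /s3 /upd gtn_eqF // /s2 /upd eqxx.
  exact: r1.
- by move: lM; rewrite xl; lia.
- by move=> i; have := bM i.+1.
exists s4; eexists; split.
- apply: ExWhileTrue; first by rewrite /= sl.
  + apply: ExSeq; first exact: ExAssign.
    apply: ExSeq; first exact: e1.
    apply: ExSeq; exact: ExAssign.
  + exact: e4.
- exact: r4.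
- move=> y hy; rewrite f4 // /s3 /upd gtn_eqF; last by lia.
  rewrite /s2 /upd gtn_eqF //.
  rewrite f1; last by lia.
  by rewrite /s0 /upd gtn_eqF //; lia.
(* Each component has size at most [M] and the two pairings add two nodes, whence the argument
   [3 * M + 2] of [q]. *)
- have sz : tree_size (enc (g, b, x)) =
      (tree_size (enc g) + tree_size (enc b) + tree_size (enc x)).+2.
    by rewrite /enc /= addSn.
  have : q.[tree_size (enc (g, b, x))]%R <= q.[3 * M + 2]%R.
    by apply: horner_nat_mono; rewrite sz; move: lM; rewrite xl; lia.
  move: c1 c4 b1M => /=; rewrite -/s2 s2l sl sg sb r1 /=.
  move: lM; rewrite xl.
  have -> : tree_size (enc_seq enc l) = tree_size (enc l) by [].
  set K := q.[_]%R; set tq := q.[_]%R; nia.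
Qed.

End Fold.

(** A polynomial-time step may double its accumulator at each round. The last hypothesis excludes
    such growth by bounding all intermediate accumulators in terms of the context. *)
Lemma poly_foldl (G A B : Type) (eG : Enc G) (eA : Enc A) (eB : Enc B)
    (F : G -> B -> A -> B) (l : G -> seq A) (b : G -> B) :
  poly_time (fun p : G * B * A => F p.1.1 p.1.2 p.2) ->
  poly_time l -> poly_time b ->
  (exists q : {poly nat}, forall g i,
     tree_size (enc (foldl (F g) (b g) (take i (l g)))) <=
       q.[tree_size (enc g)]%R) ->
  poly_time (fun g => foldl (F g) (b g) (l g)).
Proof.
move=> [pF [N [q pFP]]] pl pb [qf hf].
have [ql hl] := poly_size pl; have [qb hb] := poly_size pb.
have [p1 [N1 [q1 h1]]] := pl; have [p2 [N2 [q2 h2]]] := pb.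
pose M := (N + N1 + N2).+1.
have pFP' (s : store) (a : G * B * A) : s 0 = enc a -> exists s' t,
    [/\ exec pF s s' t, s' 0 = enc (F a.1.1 a.1.2 a.2),
        forall y, M <= y -> s' y = s y
      & t <= q.[tree_size (enc a)]%R].
  move=> /pFP [s' [t [e r f c]]]; exists s', t; split=> // y hy.
  by apply: f; lia.
pose bd n := n + ql.[n]%R + qf.[n]%R.
apply: (@poly_time_intro _ _ _ _ _
  (CSeq (CAssign M (EVar 0))
  (CSeq p1
  (CSeq (CAssign M.+1 (EVar 0))
  (CSeq (CAssign 0 (EVar M))
  (CSeq p2
  (CSeq (CAssign M.+2 (EVar 0))
  (CSeq (fold_loop pF M) (CAssign 0 (EVar M.+2)))))))))
  M.+3
  (fun n => (n + n + n + q1.[n]%R + q2.[n]%R + qb.[n]%R) + (ql.[n]%R + qf.[n]%R) +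
     (ql.[n]%R + 1) * (q.[3 * bd n + 2]%R + 20 * bd n + 20) + 100)).
  by rewrite /bd; polybound_tac.
move=> s g sg.
pose s0 := upd s M (s 0).
have [|s1 [t1 [e1 r1 f1 c1]]] := h1 s0 g; first by rewrite /s0 /upd.
pose s2 := upd s1 M.+1 (s1 0); pose s3 := upd s2 0 (s2 M).
have s1M : s1 M = enc g.
  by rewrite f1 ?/s0 ?/upd ?eqxx //; lia.
have s2M : s2 M = enc g by rewrite /s2 /upd ltn_eqF.
have s30 : s3 0 = enc g by rewrite /s3 /upd.
have [s4 [t4 [e4 r4 f4 c4]]] := h2 s3 g s30.
pose s5 := upd s4 M.+2 (s4 0).
have gM : tree_size (enc g) <= bd (tree_size (enc g)) by rewrite /bd; lia.
have lM : tree_size (enc (l g)) <= bd (tree_size (enc g)).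
  by rewrite /bd; have := hl g; lia.
have bM i : tree_size (enc (foldl (F g) (b g) (take i (l g)))) <=
    bd (tree_size (enc g)).
  by rewrite /bd; have := hf g i; lia.
have [|||s6 [t6 [e6 r6 f6 c6]]] := @fold_loopP _ _ _ _ _ _ _ _ _ _ (ltn0Sn _) pFP' g
  (bd (tree_size (enc g))) (l g) (b g) s5 _ _ _ gM lM bM.
- rewrite /s5 /upd ltn_eqF // f4; last by lia.
  by rewrite /s3 /upd.
- rewrite /s5 /upd ltn_eqF // f4; last by lia.
  by rewrite /s3 /upd /= /s2 /upd eqxx.
- by rewrite /s5 /upd eqxx.
eexists (upd s6 0 _), _; split.
- apply: ExSeq; first exact: ExAssign.
  apply: ExSeq; first exact: e1.
  apply: ExSeq; first exact: ExAssign.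
  apply: ExSeq; first exact: ExAssign.
  apply: ExSeq; first exact: e4.
  apply: ExSeq; first exact: ExAssign.
  apply: ExSeq; first exact: e6.
  exact: ExAssign.
- by rewrite /upd /= r6.
- move=> y Ny; rewrite /upd gtn_eqF; last by lia.
  rewrite f6 // /s5 /upd gtn_eqF // f4; last by lia.
  rewrite /s3 /upd gtn_eqF; last by lia.
  rewrite /s2 /upd gtn_eqF; last by lia.
  rewrite f1; last by lia.
  by rewrite /s0 /upd gtn_eqF //; lia.
- rewrite /= r6 r4 r1 /upd ltn_eqF // s1M sg.
  have := hl g; have := hb g; have := hf g (size (l g)); rewrite take_size.
  have := size_enc_seq eA (l g).
  move=> k1 k2 k3 k4.
  have : (size (l g)).+1 * (q.[3 * bd (tree_size (enc g)) + 2]%R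
          + 20 * bd (tree_size (enc g)) + 20) <=
        (ql.[tree_size (enc g)]%R + 1) * (q.[3 * bd (tree_size (enc g)) + 2]%R
          + 20 * bd (tree_size (enc g)) + 20).
    by rewrite leq_mul2r; apply/orP; right; lia.
  set P := (_.+1 * _); lia.
Qed.

(** * Polynomial-time operations on booleans and lists *)

Section Combinators.

Variables (G A B : Type).
Context (eG : Enc G) (eA : Enc A) (eB : Enc B).

Lemma poly_fst_of (f : G -> A * B) : poly_time f -> poly_time (fun g => (f g).1).
Proof. exact: poly_comp (poly_fst eA eB). Qed.

Lemma poly_snd_of (f : G -> A * B) : poly_time f -> poly_time (fun g => (f g).2).
Proof. exact: poly_comp (poly_snd eA eB). Qed.

Lemma poly_cons (x : G -> A) (s : G -> seq A) :
  poly_time x -> poly_time s -> poly_time (fun g => x g :: s g).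
Proof.
move=> px ps.
have pc : poly_time (fun p : A * seq A => p.1 :: p.2) by apply: poly_recode; case.
exact: (poly_comp pc (poly_pair px ps)).
Qed.

Lemma poly_if (c : G -> bool) (f g : G -> A) :
  poly_time c -> poly_time f -> poly_time g ->
  poly_time (fun a => if c a then f a else g a).
Proof.
move=> pc pf pg.
(* [true] has the same code as [[:: tt]], and [false] the same as the empty list, so a branch is a
   case of [poly_match]. *)
have pl : poly_time (fun a => nseq (c a) tt).
  have pb : poly_time (fun b : bool => nseq b tt) by apply: poly_recode; case.
  exact: (poly_comp pb pc).
have pf' : poly_time (fun p : G * (unit * seq unit) => f p.1).
  exact: (poly_comp pf (poly_fst _ _)).
apply: (poly_ext _ (poly_match (f := fun a _ _ => f a) pl pf' pg)) => a.
by case: (c a).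
Qed.

End Combinators.

Section Boolean.

Variables (G : Type) (eG : Enc G).

Lemma poly_negb (b : G -> bool) : poly_time b -> poly_time (fun g => ~~ b g).
Proof.
by move=> pb; apply: poly_if => //; apply: poly_const.
Qed.

Lemma poly_andb (b c : G -> bool) :
  poly_time b -> poly_time c -> poly_time (fun g => b g && c g).
Proof.
by move=> pb pc; apply: poly_if => //; apply: poly_const.
Qed.

Lemma poly_orb (b c : G -> bool) :
  poly_time b -> poly_time c -> poly_time (fun g => b g || c g).
Proof.
by move=> pb pc; apply: poly_if => //; apply: poly_const.
Qed.

Lemma poly_implb (b c : G -> bool) :
  poly_time b -> poly_time c -> poly_time (fun g => b g ==> c g).
Proof.
by move=> pb pc; apply: poly_if => //; apply: poly_const.
Qed.

End Boolean.

Section EncodedSize.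

Variables (G A B : Type).
Context (eG : Enc G) (eA : Enc A) (eB : Enc B).

Lemma size_enc_cat (s1 s2 : seq A) :
  (tree_size (enc (s1 ++ s2))).+1 = tree_size (enc s1) + tree_size (enc s2).
Proof.
elim: s1 => [|x s1 IHs] //=.
by move: IHs; rewrite /enc /= /enc; lia.
Qed.

Lemma size_enc_catrev (s1 s2 : seq A) :
  (tree_size (enc (catrev s1 s2))).+1 = tree_size (enc s1) + tree_size (enc s2).
Proof.
elim: s1 s2 => [|x s1 IHs] s2 //=.
by rewrite IHs /enc /= /enc; lia.
Qed.

Lemma size_enc_filter (P : pred A) (s : seq A) :
  tree_size (enc (filter P s)) <= tree_size (enc s).
Proof.
elim: s => [|x s IHs] //=; case: (P x); move: IHs; rewrite /enc /= /enc; lia.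
Qed.

Lemma size_enc_map (f : A -> B) (m : nat) (s : seq A) :
  (forall x, tree_size (enc x) <= tree_size (enc s) -> tree_size (enc (f x)) <= m) ->
  tree_size (enc (map f s)) <= (size s) * m.+1 + 1.
Proof.
elim: s => [|x s IHs] //= h.
have {}IHs : tree_size (enc (map f s)) <= size s * m.+1 + 1.
  by apply: IHs => y hy; apply: h; move: hy; rewrite /enc /= /enc; lia.
have : tree_size (enc (f x)) <= m by apply: h; rewrite /enc /= /enc; lia.
by move: IHs; rewrite /enc /= /enc; lia.
Qed.

Lemma foldl_cons (s1 s2 : seq A) :
  foldl (fun s x => x :: s) s2 s1 = catrev s1 s2.
Proof. by elim: s1 s2 => //= x s1 IHs s2; rewrite IHs. Qed.

Lemma poly_catrev (s1 s2 : G -> seq A) :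
  poly_time s1 -> poly_time s2 -> poly_time (fun g => catrev (s1 g) (s2 g)).
Proof.
move=> p1 p2; have [q1 h1] := poly_size p1; have [q2 h2] := poly_size p2.
apply: (poly_ext (fun g => foldl_cons (s1 g) (s2 g))).
apply: (poly_foldl (F := fun _ s x => x :: s)) => //.
- by apply: poly_cons; [exact: poly_snd | exact: poly_snd_of (poly_fst _ _)].
exists (q1 + q2)%R => g i; rewrite foldl_cons hornerD.
have := size_enc_catrev (take i (s1 g)) (s2 g).
by have := size_enc_take eA (s1 g) i; have := h1 g; have := h2 g; lia.
Qed.

End EncodedSize.

Section Concatenation.

Variables (G A : Type).
Context (eG : Enc G) (eA : Enc A).

Lemma poly_rev (s : G -> seq A) : poly_time s -> poly_time (fun g => rev (s g)).
Proof. by move=> ps; apply: poly_catrev => //; apply: poly_const. Qed.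

Lemma poly_cat (s1 s2 : G -> seq A) :
  poly_time s1 -> poly_time s2 -> poly_time (fun g => s1 g ++ s2 g).
Proof.
move=> p1 p2.
apply: (@poly_ext _ _ _ _ (fun g => catrev (rev (s1 g)) (s2 g))) => [g|].
  by rewrite catrevE revK.
by apply: poly_catrev => //; apply: poly_rev.
Qed.

End Concatenation.

Section MapFlatten.

Variables (G A B : Type).
Context (eG : Enc G) (eA : Enc A) (eB : Enc B).

Lemma foldl_map_catrev (f : A -> B) (s : seq A) t :
  foldl (fun r x => f x :: r) t s = catrev (map f s) t.
Proof. by elim: s t => //= x s IHs t; rewrite IHs. Qed.

Lemma poly_map (f : G -> A -> B) (s : G -> seq A) :
  poly_time (fun p : G * A => f p.1 p.2) -> poly_time s ->
  poly_time (fun g => [seq f g x | x <- s g]).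
Proof.
move=> pf ps; have [qf hf] := poly_size pf; have [qs hs] := poly_size ps.
apply: (@poly_ext _ _ _ _ (fun g => rev (foldl (fun r x => f g x :: r) [::] (s g)))) => [g|].
  by rewrite foldl_map_catrev revK.
apply: poly_rev.
apply: (poly_foldl (F := fun g r x => f g x :: r)) => //.
- apply: poly_cons.
    apply: (poly_comp (f := fun p : G * seq B * A => (p.1.1, p.2)) pf).
    apply: poly_pair; last exact: poly_snd.
    exact: poly_fst_of (poly_fst _ _).
  exact: poly_snd_of (poly_fst _ _).
- exact: poly_const.
have [q hq] : polybound (fun n => qs.[n]%R * (qf.[n + qs.[n]%R + 1]%R + 1) + 1).
  by polybound_tac.
exists q => g i; apply: leq_trans (hq _).
rewrite foldl_map_catrev.
have := size_enc_catrev eB [seq f g x | x <- take i (s g)] [::].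
rewrite [tree_size (enc [::])]/= addn1 => -[->].
set m := qf.[_]%R.
have : forall x, tree_size (enc x) <= tree_size (enc (take i (s g))) ->
    tree_size (enc (f g x)) <= m.
  move=> x hx; apply: leq_trans (hf (g, x)) _; apply: horner_nat_mono.
  have := hs g; have := size_enc_take eA (s g) i; move: hx.
  by rewrite /enc /= /enc; lia.
move/size_enc_map => h; apply: leq_trans h _.
rewrite leq_add2r addn1 leq_mul2r; apply/orP; right.
have := hs g; have := size_enc_take eA (s g) i.
by have := size_enc_seq eA (take i (s g)); lia.
Qed.

Lemma foldl_cat_flatten (ss : seq (seq A)) t :
  foldl (fun r x => r ++ x) t ss = t ++ flatten ss.
Proof. by elim: ss t => [|x ss IHs] t /=; rewrite ?cats0 // IHs catA. Qed.

Lemma poly_flatten (ss : G -> seq (seq A)) :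
  poly_time ss -> poly_time (fun g => flatten (ss g)).
Proof.
move=> ps; have [q hq] := poly_size ps.
apply: (poly_ext (fun g => foldl_cat_flatten (ss g) [::])).
apply: (poly_foldl (F := fun _ r x => r ++ x)) => //.
- apply: poly_cat; last exact: poly_snd.
  exact: poly_snd_of (poly_fst _ _).
- exact: poly_const.
exists q => g i; rewrite foldl_cat_flatten /=.
apply: leq_trans (leq_trans (size_enc_take _ _ i) (hq g)).
elim: (take i (ss g)) => //= x r IHr.
have := size_enc_cat eA x (flatten r); move: IHr.
by rewrite /enc /= /enc; lia.
Qed.

End MapFlatten.

Section Filtering.

Variables (G A : Type).
Context (eG : Enc G) (eA : Enc A).

Lemma poly_filter (P : G -> A -> bool) (s : G -> seq A) :
  poly_time (fun p : G * A => P p.1 p.2) -> poly_time s ->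
  poly_time (fun g => [seq x <- s g | P g x]).
Proof.
move=> pP ps.
apply: (@poly_ext _ _ _ _ (fun g => flatten [seq if P g x then [:: x] else [::] | x <- s g])) => [g|].
  by elim: (s g) => //= x r ->; case: ifP.
apply: poly_flatten.
apply: (poly_map (f := fun g x => if P g x then [:: x] else [::])) => //.
apply: poly_if => //; last exact: poly_const.
by apply: poly_cons; [exact: poly_snd | exact: poly_const].
Qed.

Lemma poly_has (P : G -> A -> bool) (s : G -> seq A) :
  poly_time (fun p : G * A => P p.1 p.2) -> poly_time s ->
  poly_time (fun g => has (fun x => P g x) (s g)).
Proof.
move=> pP ps.
apply: (@poly_ext _ _ _ _ (fun g => (if [seq x <- s g | P g x] is _ :: _ then true else false))) => [g|].
  by elim: (s g) => //= x r <-; case: (P g x).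
apply: (poly_match (f := fun _ _ _ => true)); [|exact: poly_const..].
exact: poly_filter.
Qed.

Lemma poly_all (P : G -> A -> bool) (s : G -> seq A) :
  poly_time (fun p : G * A => P p.1 p.2) -> poly_time s ->
  poly_time (fun g => all (fun x => P g x) (s g)).
Proof.
move=> pP ps.
apply: (@poly_ext _ _ _ _ (fun g => ~~ has (fun x => ~~ P g x) (s g))) => [g|].
  by rewrite has_predC negbK.
apply: poly_negb; apply: (poly_has (P := fun g x => ~~ P g x)) => //.
exact: poly_negb.
Qed.

End Filtering.

(** A greatest fixpoint computed with the list itself as a clock, which keeps it within the scope of
    [poly_foldl]. *)
Definition shrink (A : Type) (P : seq A -> A -> bool) (s : seq A) : seq A :=
  foldl (fun X _ => [seq x <- X | P X x]) s s.

Lemma poly_shrink (G A : Type) (eG : Enc G) (eA : Enc A) (P : G -> seq A -> A -> bool) (s : G -> seq A) :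
  poly_time (fun p : G * seq A * A => P p.1.1 p.1.2 p.2) -> poly_time s ->
  poly_time (fun g => shrink (P g) (s g)).
Proof.
move=> pP ps; have [q hq] := poly_size ps.
apply: (poly_foldl (F := fun g X _ => [seq x <- X | P g X x])) => //.
  apply: (poly_filter (P := fun (p : G * seq A * A) x => P p.1.1 p.1.2 x)).
    apply: (poly_comp (f := fun p : G * seq A * A * A => (p.1.1, p.2)) pP).
    by apply: poly_pair; [exact: poly_fst_of (poly_fst _ _) | exact: poly_snd].
  exact: poly_snd_of (poly_fst _ _).
exists q => g i; apply: leq_trans (hq g).
move: (s g) => r; move: (take i r) => l; elim: l r => //= x l IHl X.
exact: leq_trans (IHl _) (size_enc_filter _ _ _).
Qed.

(** * Equality tests, removal of duplicates, words of bounded length *)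

Definition poly_eq (A : eqType) {eA : Enc A} : Prop :=
  poly_time (fun p : A * A => p.1 == p.2).
Arguments poly_eq A {eA}.

Lemma poly_eq_of (G : Type) (A : eqType) (eG : Enc G) (eA : Enc A) (x y : G -> A) :
  poly_eq A -> poly_time x -> poly_time y -> poly_time (fun g => x g == y g).
Proof. move=> pA px py; exact: (poly_comp pA (poly_pair px py)). Qed.

Lemma poly_mem (G : Type) (A : eqType) (eG : Enc G) (eA : Enc A)
    (x : G -> A) (s : G -> seq A) :
  poly_eq A -> poly_time x -> poly_time s -> poly_time (fun g => x g \in s g).
Proof.
move=> pA px ps.
apply: (poly_ext (fun g => has_pred1 (x g) (s g))).
apply: (poly_has (P := fun g y => y == x g)) => //.
apply: poly_eq_of => //; first exact: poly_snd.
exact: (poly_comp px (poly_fst _ _)).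
Qed.

Lemma poly_eq_bool : poly_eq bool.
Proof.
apply: (@poly_ext _ _ _ _ (fun p => (if p.1 then p.2 else ~~ p.2))) => [p|].
  by case: p => -[] [].
by apply: poly_if; [exact: poly_fst | exact: poly_snd | apply: poly_negb; exact: poly_snd].
Qed.

Lemma poly_eq_pair (A B : eqType) (eA : Enc A) (eB : Enc B) :
  poly_eq A -> poly_eq B -> poly_eq (A * B)%type.
Proof.
move=> pA pB.
apply: (@poly_ext _ _ _ _ (fun p => (p.1.1 == p.2.1) && (p.1.2 == p.2.2))) => [p|].
  by case: p => -[a b] [c d].
apply: poly_andb; apply: poly_eq_of => //.
- exact: poly_fst_of (poly_fst _ _).
- exact: poly_fst_of (poly_snd _ _).
- exact: poly_snd_of (poly_fst _ _).
- exact: poly_snd_of (poly_snd _ _).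
Qed.

(** Equality of lists as a fold over one of them: the accumulator carries the verdict so far and
    what is left of the other. *)
Definition eq_step (A : eqType) (br : bool * seq A) (x : A) : bool * seq A :=
  if br.2 is y :: r then (br.1 && (x == y), r) else (false, [::]).

Lemma foldl_eq_step (A : eqType) (s r : seq A) b :
  (foldl (@eq_step A) (b, r) s).1 && nilp (foldl (@eq_step A) (b, r) s).2 =
  b && (s == r).
Proof.
elim: s b r => [|x s IHs] b [|y r] //=; first by rewrite IHs andbF.
by rewrite IHs eqseq_cons andbA.
Qed.

Lemma poly_nilp (G A : Type) (eG : Enc G) (eA : Enc A) (s : G -> seq A) :
  poly_time s -> poly_time (fun g => nilp (s g)).
Proof.
move=> ps.
apply: (@poly_ext _ _ _ _ (fun g => (if s g is _ :: _ then false else true))) => [g|].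
  by case: (s g).
by apply: (poly_match (f := fun _ _ _ => false)); [|exact: poly_const..].
Qed.

Lemma poly_eq_seq (A : eqType) (eA : Enc A) : poly_eq A -> poly_eq (seq A).
Proof.
move=> pA.
apply: (poly_ext (fun p => (foldl_eq_step p.1 p.2 true))).
have pF : poly_time (fun p : seq A * seq A => foldl (@eq_step A) (true, p.2) p.1).
  apply: (poly_foldl (F := fun _ => @eq_step A)).
  - apply: (poly_match (l := fun p : _ * (bool * seq A) * A => p.1.2.2)
      (f := fun p y r => (p.1.2.1 && (p.2 == y), r))).
    + exact: poly_snd_of (poly_snd_of (poly_fst _ _)).
    + apply: poly_pair; last exact: poly_snd_of (poly_snd _ _).
      apply: poly_andb.
        exact: poly_fst_of (poly_snd_of (poly_fst_of (poly_fst _ _))).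
      apply: poly_eq_of => //; first exact: poly_snd_of (poly_fst _ _).
      exact: poly_fst_of (poly_snd _ _).
    + exact: poly_const.
  - exact: poly_fst.
  - by apply: poly_pair; [exact: poly_const | exact: poly_snd].
  (* The flag has a code of size at most 3, and pairing adds one node. *)
  have [q hq] : polybound (fun n => n + 4) by polybound_tac.
  exists q => -[s r] i; apply: leq_trans (hq _); rewrite /= .
  apply: (@leq_trans (tree_size (enc r) + 4)); last by rewrite /enc /= /enc; lia.
  have h (l : seq A) (b : bool) (t : seq A) : tree_size (enc t) <= tree_size (enc r) ->
      tree_size (enc (foldl (@eq_step A) (b, t) l)) <= tree_size (enc r) + 4.
    elim: l b t => [|x l IHl] b t ht /=.
    by move: ht; rewrite /enc /= /enc; case: b => /=; lia.
  case: t ht => [|y t] ht; apply: IHl => //.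
  by move: ht; rewrite /enc /= /enc; lia.
  exact: h (leqnn _).
apply: poly_andb; first exact: poly_fst_of pF.
exact: poly_nilp (poly_snd_of pF).
Qed.

Lemma poly_seq_of_opt (A : Type) (eA : Enc A) : poly_time (@seq_of_opt A).
Proof. by apply: poly_recode; case. Qed.

Lemma poly_eq_option (A : eqType) (eA : Enc A) : poly_eq A -> poly_eq (option A).
Proof.
move=> pA.
apply: (@poly_ext _ _ _ _ (fun p => (seq_of_opt p.1 == seq_of_opt p.2))) => [p|].
  by case: p => -[x|] [y|] //=; rewrite eqseq_cons andbT.
apply: poly_eq_of; first exact: poly_eq_seq.
- exact: (poly_comp (poly_seq_of_opt _) (poly_fst _ _)).
- exact: (poly_comp (poly_seq_of_opt _) (poly_snd _ _)).
Qed.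

Definition dedup (A : eqType) (s : seq A) : seq A :=
  foldl (fun r x => if x \in r then r else x :: r) [::] s.

Lemma dedupP (A : eqType) (s : seq A) : uniq (dedup s) /\ dedup s =i s.
Proof.
suff h t : uniq t -> uniq (foldl (fun r x => if x \in r then r else x :: r) t s) /\
    foldl (fun r x => if x \in r then r else x :: r) t s =i s ++ t by
  have [? h2] := h [::] isT; split=> // x; rewrite h2 cats0.
elim: s t => //= x s IHs t ut; case: ifP => [xt|/negbT xt].
  have [u1 h1] := IHs t ut; split=> // y; rewrite h1 !inE !mem_cat.
  by case: eqP => // ->; rewrite xt orbT.
have [|u1 h1] := IHs (x :: t); first by rewrite /= xt.
by split=> // y; rewrite h1 !inE !mem_cat !inE orbCA.
Qed.

Lemma poly_dedup (G : Type) (A : eqType) (eG : Enc G) (eA : Enc A) (s : G -> seq A) :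
  poly_eq A -> poly_time s -> poly_time (fun g => dedup (s g)).
Proof.
move=> pA ps; have [q hq] := poly_size ps.
apply: (poly_foldl (F := fun _ r x => if x \in r then r else x :: r)) => //.
- apply: poly_if.
  + apply: poly_mem => //; first exact: poly_snd.
    exact: poly_snd_of (poly_fst _ _).
  + exact: poly_snd_of (poly_fst _ _).
  + apply: poly_cons; first exact: poly_snd.
    exact: poly_snd_of (poly_fst _ _).
- exact: poly_const.
exists q => g i; apply: leq_trans (leq_trans (size_enc_take _ _ i) (hq g)).
have h (r t : seq A) :
    (tree_size (enc (foldl (fun r x => if x \in r then r else x :: r) t r))).+1 <=
      tree_size (enc r) + tree_size (enc t).
  elim: r t => [|x r IHr] t //=.
  case: ifP => _; [have := IHr t|have := IHr (x :: t)]; rewrite /enc /= /enc; lia.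
by have := h (take i (s g)) [::]; rewrite [tree_size (enc [::])]/= addn1 ltnS.
Qed.

Section Words.

Variable A : Type.

Fixpoint words (n : nat) (s : seq A) : seq (seq A) :=
  if n is n'.+1 then
    words n' s ++ flatten [seq [seq x :: r | r <- words n' s] | x <- s]
  else [:: [::]].

(** The recursion on [n] takes place outside the machine: each level composes finitely many
    polynomial-time operations. The polynomial depends on [n], which is why [c] and [k] are fixed in
    advance. *)
Lemma poly_words n (eA : Enc A) : poly_time (words n).
Proof.
elim: n => [|n IHn]; first exact: poly_const.
apply: poly_cat => //; apply: poly_flatten.
apply: (poly_map (f := fun s x => [seq x :: r | r <- words n s])); last exact: poly_id.
apply: (poly_map (f := fun (p : seq A * A) r => p.2 :: r)).
  by apply: poly_cons; [exact: poly_snd_of (poly_fst _ _) | exact: poly_snd].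
exact: (poly_comp IHn (poly_fst _ _)).
Qed.

End Words.

Lemma mem_words (A : eqType) n (s r : seq A) :
  (r \in words n s) = (size r <= n) && all (mem s) r.
Proof.
elim: n r => [|n IHn] r /=; first by case: r.
rewrite mem_cat IHn; apply/orP/andP => [[/andP [h1 h2]|]|[h1 h2]].
- by split=> //; lia.
- move/flattenP => [_ /mapP [x xs ->] /mapP [t]]; rewrite IHn => /andP [h1 h2] ->.
  by split=> //=; rewrite h2 andbT.
- case: (leqP (size r) n) => hr; [by left; apply/andP|right].
  case: r h1 h2 hr => //= x r h1 /andP [xs rs] _.
  apply/flattenP; exists [seq x :: t | t <- words n s]; first by apply/mapP; exists x.
  by apply/mapP; exists r => //; rewrite IHn -ltnS h1.
Qed.

(** * Extensions and stable sets of letters *)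

Lemma sat_lit v (l : literal) : sat v (lit_formula l) = (v l.2 == l.1).
Proof. by case: l => -[] y; rewrite /lit_formula /=; case: (v y). Qed.

Definition lit_closure (G : literal -> Prop) : formula -> Prop :=
  logical_closure (fun f => exists2 l, G l & f = lit_formula l).

Lemma lit_closure_in (G : literal -> Prop) l : G l -> lit_closure G (lit_formula l).
Proof. by move=> Gl v; apply; exists l. Qed.

Lemma lit_closure_trans (G : literal -> Prop) (T : formula -> Prop) f :
  (forall g, T g -> lit_closure G g) -> logical_closure T f -> lit_closure G f.
Proof. by move=> h hf v hv; apply: hf => g /h; apply. Qed.

Lemma lit_closure_lit (G : literal -> Prop) l :
  (forall y, G (true, y) -> ~ G (false, y)) ->
  lit_closure G (lit_formula l) -> G l.
Proof.
move=> cG hl; apply: contrapT => nGl.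
(* This valuation falsifies [l] and elsewhere follows the positive literals of [G]; since [l] is
   outside [G], it satisfies all of [G]. *)
have : sat (fun y => if y == l.2 then ~~ l.1 else `[< G (true, y) >]) (lit_formula l).
  apply: hl => _ [[b z] Gbz ->]; rewrite sat_lit /=; case: (eqVneq z l.2) => [ez|_].
    case: (eqVneq b l.1) => [eb|].
      by case: nGl; have <- : (b, z) = l by rewrite eb ez -surjective_pairing.
    by case: b {Gbz}; case: (l.1).
  case: b Gbz => Gz; first by apply/eqP/asboolP.
  by apply/eqP/negbTE/asboolPn => /cG.
by rewrite sat_lit eqxx; case: (l.1).
Qed.

Definition on (T : pred letter) (o : option letter) : bool :=
  all T (seq_of_opt o).

Definition neg_support (ds : seq default) (w : seq literal) (T : pred letter)
    (y : letter) : bool :=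
  ((false, y) \in w) || has (fun d => (d.2 == (false, y)) && on T d.1) ds.

(** A letter outside [T] may be undecided: its negation is in the extension only if supported, and
    is then unblocked because the letter is absent. *)
Definition holds ds w (T : pred letter) (l : literal) : bool :=
  if l.1 then T l.2 else ~~ T l.2 && neg_support ds w T l.2.

(** The unfounded sets of logic programming, for positive conclusions. An empty prerequisite is
    satisfied in every set, so a prerequisite-free default always founds its conclusion. *)
Definition unfounded_at (ds : seq default) (w : seq literal)
    (T U : pred letter) (y : letter) : bool :=
  ((true, y) \notin w) &&
  all (fun d => (d.2 == (true, y)) ==> ~~ on (fun x => T x && ~~ U x) d.1) ds.

(** A triggered positive default may fail to apply only when blocked, that is, when the opposite of
    its conclusion is supported. *)
Definition closed_at ds w (T : pred letter) (d : default) : bool :=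
  (on T d.1 && d.2.1) ==> (T d.2.2 || neg_support ds w T d.2.2).

(* The sets of letters that are true in some extension. *)
Record stable (ds : seq default) (w : seq literal) (T : pred letter) : Prop := {
  stable_pos : forall y, (true, y) \in w -> T y;
  stable_neg : forall y, T y -> (false, y) \notin w;
  stable_closed : forall d, d \in ds -> closed_at ds w T d;
  stable_founded : forall U : pred letter,
    (forall y, T y -> U y -> unfounded_at ds w T U y) -> forall y, T y -> ~~ U y
}.

Definition lit_consistent (w : seq literal) : Prop :=
  forall y, (true, y) \in w -> (false, y) \notin w.

Section ExtensionStable.

Variables (D : {fset default}) (W : {fset literal}).
Variables (ds : seq default) (w : seq literal).
Hypothesis dsD : ds =i D.
Hypothesis wW : w =i W.
Hypothesis w_cons : lit_consistent w.

(** The generating literals [G] are those of [W] and the conclusions of defaults applied in [E].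
    They are consistent and entail every stage, so by [lit_closure_lit] they are the only literals
    of [E]. *)
Lemma extension_stable E : extension D W E ->
  exists2 T, stable ds w T & forall l, E (lit_formula l) <-> holds ds w T l.
Proof.
move=> extE.
pose G l := l \in W \/ exists d, [/\ d \in D, prereq_in d.1 E,
  ~ E (lit_formula (lneg d.2)) & l = d.2].
have inE f i : stage D W E i f -> E f by move=> h; apply/extE; exists i.
have GE l : G l -> E (lit_formula l).
  case=> [lW|[d [dD pd nd ->]]]; first by apply: (inE _ 0); exists l.
  have [i hi] : exists i, prereq_in d.1 (stage D W E i).
    by case: (d.1) pd => [a /extE //|_]; exists 0.
  by apply: (inE _ i.+1); right; exists d.
(* An applied default requires the opposite of its conclusion to be absent from [E], whereas [GE]
   puts both literals in [E]; two facts would contradict [w_cons]. *)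
have cG y : G (true, y) -> ~ G (false, y).
  move=> Gt Gf; case: (Gt); case: (Gf).
  - by rewrite -!wW => h1 /w_cons; rewrite h1.
  - by case=> d [_ _ + e] _; apply; rewrite -e; apply: GE.
  - by move=> _ [d [_ _ + e]]; apply; rewrite -e; apply: GE.
  - by case=> d [_ _ + e] _; apply; rewrite -e; apply: GE.
have stG i f : stage D W E i f -> lit_closure G f.
  elim: i f => [|i IHi] f /=; first by case=> l lW ->; apply: lit_closure_in; left.
  case=> [|[d [dD pd nd ->]]]; first exact: lit_closure_trans.
  apply: lit_closure_in; right; exists d; split=> //.
  by case: (d.1) pd => // a; apply: inE.
have EG l : E (lit_formula l) <-> G l.
  split; last exact: GE.
  by move/extE => [i /stG]; apply: lit_closure_lit.
pose T : pred letter := fun y => `[< G (true, y) >].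
have onP o : on T o <-> prereq_in o E.
  case: o => [a|] //=; rewrite /on /= andbT.
  by rewrite (EG (true, a)); split=> /asboolP.
have negG y : ~~ T y && neg_support ds w T y <-> G (false, y).
  split.
    case/andP => nT /orP [|/hasP [d dD /andP [/eqP e od]]]; first by left; rewrite -wW.
    right; exists d; split; rewrite -?dsD //; first exact/onP.
    rewrite e /lneg /= => /EG h; move: nT; rewrite /T.
    by move/asboolP.
  move=> Gf; apply/andP; split; first by apply/asboolP => /cG.
  case: Gf => [|[d [dD /onP od nd e]]]; first by rewrite -wW /neg_support => ->.
  by apply/orP; right; apply/hasP; exists d; rewrite ?dsD // -e eqxx.
exists T; last first.
  case=> -[] y; rewrite EG /holds /=; last by rewrite negG.
  by split=> /asboolP.
split.
- by move=> y; rewrite wW => h; apply/asboolP; left.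
- move=> y /asboolP /cG h; apply/negP => hy; apply: h; left.
  by rewrite -wW.
- move=> [o [b y]] dD; apply/implyP => /andP [/= /onP od]; case: b dD => // dD _.
  case: (pselect (E (lit_formula (false, y)))) => h.
    by move/EG: h => /(proj2 (negG y)) /andP [_ ->]; rewrite orbT.
  apply/orP; left; apply/asboolP; right.
  by exists (o, (true, y)); split; rewrite -?dsD.
- move=> U unfU.
  (* If [U] is unfounded, the generators without the letters of [U] already entail every stage, so
     no letter of [T] lies in [U]. *)
  pose G' l := G l /\ ~ (l.1 /\ U l.2).
  have cG' y : G' (true, y) -> ~ G' (false, y).
    by move=> [h _] [h' _]; apply: cG h h'.
  have stG' i f : stage D W E i f -> lit_closure G' f.
    elim: i f => [|i IHi] f /=.
      case=> -[b y] lW ->; apply: lit_closure_in; split; first by left.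
      move=> /= [bt Uy]; move: lW; rewrite bt -wW => lW.
      have /unfU : T y by apply/asboolP; left; rewrite -wW.
      by move=> /(_ Uy) /andP [/negP].
    case=> [|[d [dD pd nd ->]]]; first exact: lit_closure_trans.
    have Gd : G d.2.
      right; exists d; split=> //.
      by case: (d.1) pd => // a; apply: inE.
    apply: lit_closure_in; split=> // -[bt Uy].
    have d2 : d.2 = (true, d.2.2) by move: bt; case: (d.2) => -[].
    have /unfU : T d.2.2 by apply/asboolP; rewrite -d2.
    move=> /(_ Uy) /andP [_ /allP /(_ d)]; rewrite dsD => /(_ dD).
    rewrite d2 eqxx /= => /negP; apply.
    case: (d.1) pd => // a /IHi /(@lit_closure_lit _ (true, a) cG') [Ga nU].
    rewrite /on /= andbT; apply/andP; split; first exact/asboolP.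
    by apply/negP => Ua; apply: nU.
  move=> y /asboolP /GE /extE [i /stG' /(lit_closure_lit cG') [_ /= nU]].
  by apply/negP => Uy; apply: nU.
Qed.

(** The extension is the closure of the literals that hold in [T]. Closedness keeps the stages
    inside it, and foundedness makes each of its literals reachable. *)
Lemma stable_extension T : stable ds w T ->
  exists2 E, extension D W E & forall l, E (lit_formula l) <-> holds ds w T l.
Proof.
case=> st1 st2 st3 st4.
pose G (l : literal) : Prop := holds ds w T l.
have cG y : G (true, y) -> ~ G (false, y).
  by rewrite /G /holds /= => ->.
pose E := lit_closure G.
have EG l : E (lit_formula l) <-> G l.
  by split; [exact: lit_closure_lit | exact: lit_closure_in].
have onP o : on T o <-> prereq_in o E.
  case: o => [a|] //=; rewrite /on /= andbT.
  by rewrite (EG (true, a)).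
exists E => // f; split; last first.
  case=> i; elim: i f => [|i IHi] f /=.
    case=> -[b y] lW ->; apply/EG; rewrite /G /holds /=.
    move: lW; rewrite -wW; case: b => lW; first exact: st1.
    rewrite /neg_support lW andbT; apply/negP => /st2.
    by rewrite lW.
  case=> [|[[o [b y]] [dD pd nd ->]]]; first exact: lit_closure_trans.
  have {pd}od : on T o by apply/onP; case: (o) pd => // a; apply: IHi.
  apply/EG; move: nd; rewrite EG /G /holds /lneg /=.
  case: b dD => /= dD; rewrite -dsD in dD.
    have /= := st3 _ dD; rewrite /closed_at /= od /=.
    by case: (T y) => //= -> [].
  move=> /negP -> /=; apply/orP; right; apply/hasP; exists (o, (false, y)) => //=.
  by rewrite eqxx.
have mono i j g : i <= j -> stage D W E i g -> stage D W E j g.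
  move=> /subnK <-; elim: (j - i) => [|n IHn] // h; rewrite addSn.
  by left=> v hv; apply: hv; apply: IHn.
have onst o : on T o -> (forall y, T y -> exists i, stage D W E i (FVar y)) ->
    exists i, prereq_in o (stage D W E i).
  by case: o => [a|] /=; [rewrite /on /= andbT => Ta; apply | exists 0].
have Tst y : T y -> exists i, stage D W E i (FVar y).
  (* The letters of [T] never reached by a stage would be unfounded. *)
  pose U : pred letter := fun y => `[< ~ exists i, stage D W E i (FVar y) >].
  suff /st4 h : forall y, T y -> U y -> unfounded_at ds w T U y.
    by move=> /h; rewrite /U => /asboolPn /contrapT.
  move=> {}y Ty /asboolP nst; apply/andP; split.
    apply/negP => yw; apply: nst; exists 0; exists (true, y) => //.
    by rewrite -wW.
  apply/allP => -[o l] dD; apply/implyP => /= /eqP el; apply/negP => oo; apply: nst.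
  have [i hi] : exists i, prereq_in o (stage D W E i).
    case: o oo {dD} => [a|] /=; last by exists 0.
    by rewrite /on /= andbT => /andP [_] /asboolPn /contrapT.
  exists i.+1; right; exists (o, l); rewrite -dsD el; split=> //.
  - by rewrite -el.
  - by rewrite EG /G /holds /= Ty.
have Gst l : G l -> exists i, stage D W E i (lit_formula l).
  case: l => -[] y; first exact: Tst.
  rewrite /G /holds /= => /andP [nT /orP [yw|/hasP [d dD /andP [/eqP e od]]]].
    by exists 0; exists (false, y); rewrite -?wW.
  have [i hi] := onst _ od Tst.
  exists i.+1; right; exists d; split; rewrite -?dsD //; last by rewrite e.
  by rewrite EG e /lneg /G /holds /=; apply/negP.
(* Only finitely many literals can hold, so one stage contains them all, and the next stage contains
   their closure. *)
have [i hi] : exists i, forall l, G l -> stage D W E i (lit_formula l).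
  pose cand := w ++ [seq d.2 | d <- ds].
  have Gc l : G l -> l \in cand.
    case: l => -[] y; last first.
      rewrite /G /holds /= => /andP [nT /orP [yw|/hasP [d dD /andP [/eqP e od]]]].
        by rewrite mem_cat yw.
      by rewrite mem_cat -e map_f ?orbT.
    move=> Gy; rewrite /G /holds /= in Gy.
    have := st4 (fun y => (true, y) \notin cand) _ _ Gy; rewrite negbK; apply.
    move=> z Tz; rewrite mem_cat negb_or => /andP [zw zd].
    rewrite /unfounded_at zw /=; apply/allP => d dD; apply/implyP => /eqP e.
    by rewrite -e map_f in zd.
  have [i hi] : exists i, forall l, l \in cand -> G l -> stage D W E i (lit_formula l).
    elim: (cand) => [|l s [i IHs]]; first by exists 0.
    case: (pselect (G l)) => [/Gst [j hj]|nG].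
      exists (maxn i j) => l'; rewrite inE => /orP [/eqP -> _|ls Gl'].
        exact: mono (leq_maxr _ _) hj.
      by apply: mono (leq_maxl _ _) _; apply: IHs.
    by exists i => l'; rewrite inE => /orP [/eqP -> //|ls]; apply: IHs.
  by exists i => l Gl; apply: hi (Gc _ Gl) Gl.
move=> Ef; exists i.+1; left => v hv; apply: Ef => _ [l Gl ->].
by apply: hv; apply: hi.
Qed.

Lemma entails_stable l : entails D W (lit_formula l) <->
  forall T, stable ds w T -> holds ds w T l.
Proof.
split=> [h T /stable_extension [E /h El HE]|h E /extension_stable [T /h Tl HE]].
  exact/HE.
exact/HE.
Qed.

End ExtensionStable.

(** * Deciding entailment of literals *)

Section Shrink.

Variables (A : eqType) (P : seq A -> A -> bool).

Let step (X : seq A) := [seq x <- X | P X x].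

(** A round either changes nothing, and the fixpoint is reached, or shortens the list; as many
    rounds as elements suffice. *)
Lemma shrink_fix (l X : seq A) : size X <= size l ->
  step (foldl (fun Y _ => step Y) X l) = foldl (fun Y _ => step Y) X l.
Proof.
elim: l X => [|y l IHl] X /=; first by case: X.
move=> le_sz; case: (boolP (all (P X) X)) => [/all_filterP e|nP].
  have -> : step X = X by [].
  have -> : foldl (fun Y _ => step Y) X l = X; last by [].
  by elim: l {IHl le_sz} => //= z l; rewrite -/(step X) [step X]e.
apply: IHl; rewrite -ltnS; apply: leq_trans le_sz.
by rewrite ltn_neqAle size_filter count_size andbT -all_count.
Qed.

Lemma shrink_stable s x : x \in shrink P s -> P (shrink P s) x.
Proof.
have e : step (shrink P s) = shrink P s by apply: shrink_fix.
by rewrite -[in X in X -> _]e mem_filter => /andP [].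
Qed.

(** A set that justifies its own elements relative to every list containing it survives each
    round. *)
Lemma shrink_largest s (X : pred A) :
  (forall Y : seq A, (forall x, X x -> x \in Y) -> forall x, X x -> P Y x) ->
  (forall x, X x -> x \in s) -> forall x, X x -> x \in shrink P s.
Proof.
move=> hX.
suff h (l Y : seq A) : (forall x, X x -> x \in Y) ->
    forall x, X x -> x \in foldl (fun Y _ => step Y) Y l by apply: h.
elim: l Y => //= y l IHl Y XY; apply: IHl => x Xx.
by rewrite mem_filter XY // andbT; apply: hX.
Qed.

End Shrink.

Section Algorithm.

Variables (ds : seq default) (w : seq literal).

Definition unfounded_part (X : seq letter) : seq letter :=
  shrink (fun U y => unfounded_at ds w (fun x => x \in X) (fun x => x \in U) y) X.

(** By the last test, a default that fails to be closed condemns its single prerequisite: a smaller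
    set supports less, so only dropping that letter can repair the failure. *)
Definition stay_at (A X : seq letter) (y : letter) : bool :=
  [&& y \notin A, (false, y) \notin w, y \notin unfounded_part X
    & all (fun d => (d.1 == Some y) ==> closed_at ds w (fun x => x \in X) d) ds].

Definition head_letters : seq letter :=
  [seq l.2 | l <- w ++ [seq d.2 | d <- ds]].

(* Stable sets that avoid [A] are closed under union, since prerequisites are  *)
(* positive and single.  This is the largest one if there is any, and is not   *)
(* stable otherwise.                                                          *)
Definition largest_avoiding (A : seq letter) : seq letter :=
  shrink (stay_at A) head_letters.

Definition avoidable (A : seq letter) : bool :=
  all (fun l => l.1 ==> (l.2 \in largest_avoiding A)) w &&
  all (closed_at ds w (fun x => x \in largest_avoiding A)) ds.

Definition neg_prereqs (y : letter) : seq letter :=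
  flatten [seq seq_of_opt d.1 | d <- [seq d <- ds | d.2 == (false, y)]].

(** A letter is entailed when no stable set avoids it. Its negation is entailed when no stable set
    contains the letter and none leaves the negation unsupported: a fact or a prerequisite-free
    default supports it, or the prerequisites of the defaults concluding it cannot all be
    avoided. *)
Definition entailsb (l : literal) : bool :=
  if l.1 then ~~ avoidable [:: l.2]
  else ~~ (avoidable [::] && (l.2 \in largest_avoiding [::])) &&
       [|| l \in w, has (fun d => (d.2 == l) && (d.1 == None)) ds
         | ~~ avoidable (l.2 :: neg_prereqs l.2)].

Lemma on_mono (T T' : pred letter) o :
  (forall x, T x -> T' x) -> on T o -> on T' o.
Proof. by move=> h; apply: sub_all. Qed.

Lemma neg_support_mono (T T' : pred letter) y :
  (forall x, T x -> T' x) -> neg_support ds w T y -> neg_support ds w T' y.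
Proof.
move=> h /orP [yw|/hasP [d dD /andP [e od]]]; first by rewrite /neg_support yw.
by apply/orP; right; apply/hasP; exists d; rewrite // e (on_mono h).
Qed.

Lemma unfounded_at_sub (T U T' U' : pred letter) y :
  (forall x, T' x && ~~ U' x -> T x && ~~ U x) ->
  unfounded_at ds w T U y -> unfounded_at ds w T' U' y.
Proof.
move=> h /andP [yw /allP hU]; rewrite /unfounded_at yw /=.
apply/allP => d /hU /implyP hd; apply/implyP => /hd; apply: contra.
exact: on_mono.
Qed.

Lemma stable_head (T : pred letter) y : stable ds w T -> T y -> y \in head_letters.
Proof.
case=> _ _ _ st4 Ty.
have := st4 (fun y => y \notin head_letters) _ _ Ty; rewrite negbK; apply.
move=> z Tz; rewrite /head_letters map_cat mem_cat negb_or => /andP [zw zd].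
apply/andP; split; first by apply: contra zw => zw; apply/mapP; exists (true, z).
apply/allP => d dD; apply/implyP => /eqP e; case/mapP: zd.
by exists d.2; [apply: map_f | rewrite e].
Qed.

(** For a superset [Y] of [T], unfoundedness relative to [Y] passes down to [T], and support in [T]
    passes up to [Y]; so no round removes a letter of [T]. *)
Lemma stable_sub_largest (T : pred letter) A : stable ds w T ->
  (forall a, a \in A -> ~~ T a) -> forall y, T y -> y \in largest_avoiding A.
Proof.
move=> stT TA; apply: shrink_largest; last by move=> x; apply: stable_head.
case: stT => _ st2 st3 st4 Y TY y Ty; apply/and4P; split.
- by apply: contraL Ty; apply: TA.
- exact: st2.
- apply: (st4 (fun z => z \in unfounded_part Y)) => // z Tz /shrink_stable.
  apply: unfounded_at_sub => x /andP [/TY -> ].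
  by [].
- apply/allP => d dD; apply/implyP => /eqP e; apply/implyP => /andP [_ d2].
  have := st3 d dD; rewrite /closed_at d2 andbT e /on /= Ty /=.
  by case/orP => [/TY -> //|/(neg_support_mono TY) ->]; rewrite orbT.
Qed.

Lemma largest_avoiding_notin A y : y \in largest_avoiding A -> y \notin A.
Proof. by move/shrink_stable => /and4P []. Qed.

Lemma largest_avoiding_stable A : avoidable A ->
  stable ds w (fun y => y \in largest_avoiding A).
Proof.
case/andP => /allP pos /allP cl; split=> //.
- by move=> y /pos.
- by move=> y /shrink_stable /and4P [].
(* An unfounded subset of the fixpoint survives the inner shrinking, hence lies in [unfounded_part],
   which [stay_at] excludes. *)
- move=> U unfU y yL; apply/negP => Uy.
  have /and4P [_ _ /negP nU _] := shrink_stable yL; apply: nU.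
  apply: (shrink_largest (X := fun y => (y \in largest_avoiding A) && U y)) => //; last first.
  + by rewrite yL.
  + by move=> x /andP [].
  move=> Y UY z /andP [zL Uz]; have := unfU _ zL Uz.
  apply: unfounded_at_sub => x /andP [xL xY]; rewrite xL /=.
  by apply: contra xY => Ux; apply: UY; rewrite xL.
Qed.

(** The fixpoint is by itself closed under defaults with a prerequisite; facts and prerequisite-free
    defaults are handled by [T], which it contains. *)
Lemma stable_avoidable (T : pred letter) A : stable ds w T ->
  (forall a, a \in A -> ~~ T a) -> avoidable A.
Proof.
move=> stT TA; have TL := stable_sub_largest stT TA.
case: (stT) => st1 _ st3 _; apply/andP; split.
  by apply/allP => -[[] y] //= /st1 /TL.
apply/allP => d dD; apply/implyP => /andP [od d2].
case e : d.1 od => [x|] => [|_]; last first.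
  have := st3 d dD; rewrite /closed_at d2 e /=.
  by case/orP => [/TL -> //|/(neg_support_mono TL) ->]; rewrite orbT.
rewrite /on /= andbT => xL; have /and4P [_ _ _ /allP /(_ d dD)] := shrink_stable xL.
by rewrite e eqxx /closed_at d2 e /on /= xL.
Qed.

Lemma entailsbP l : reflect (forall T, stable ds w T -> holds ds w T l) (entailsb l).
Proof.
case: l => -[] y; rewrite /entailsb /holds /=.
  apply: (iffP negP) => [nav T stT|h av].
    apply: contrapT => nT; apply: nav; apply: (stable_avoidable stT) => a.
    by rewrite inE => /eqP ->; apply/negP.
  have := h _ (largest_avoiding_stable av).
  by move/largest_avoiding_notin; rewrite inE eqxx.
apply: (iffP andP) => [[nyL h] T stT|h].
  have nT : ~~ T y.
    apply: contra nyL => Ty; apply/andP; split; first exact: (stable_avoidable stT).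
    exact: (stable_sub_largest stT).
  rewrite nT /=; case/or3P: h => [yw|/hasP [d dD /andP [e /eqP e0]]|].
  - by rewrite /neg_support yw.
  - by apply/orP; right; apply/hasP; exists d => //; rewrite e e0.
  - apply: contraR => ns; apply: (stable_avoidable stT) => a.
    rewrite inE => /orP [/eqP -> //|/flattenP [s /mapP [d]]].
    rewrite mem_filter => /andP [/eqP e dD] -> {s}.
    case e1 : d.1 => [x|] //=; rewrite inE => /eqP ->.
    apply: contra ns => Tx; apply/orP; right; apply/hasP; exists d => //.
    by rewrite e eqxx e1 /on /= Tx.
split.
  by apply/negP => /andP [/largest_avoiding_stable /h /andP [/negP]].
case: (boolP (avoidable (y :: neg_prereqs y))) => [av|]; last by rewrite !orbT.
have /andP [_ /orP [-> //|/hasP [d dD /andP [/eqP e od]]]] := h _ (largest_avoiding_stable av).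
apply/or3P/Or32/hasP; exists d => //; rewrite e eqxx /=.
case e1 : d.1 od => [x|] //; rewrite /on /= andbT => /largest_avoiding_notin.
rewrite inE negb_or => /andP [_ /negP []]; apply/flattenP; exists (seq_of_opt d.1).
  by apply/mapP; exists d; rewrite // mem_filter dD e eqxx.
by rewrite e1 inE.
Qed.

End Algorithm.

(** * Locality of entailment and small witness sets *)

Section Locality.

Variables (ds : seq default) (w1 w2 : seq literal) (C : pred letter).
Hypothesis w1_cons : lit_consistent w1.
Hypothesis C_closed : forall d, d \in ds -> C d.2.2 -> on C d.1.
Hypothesis w12 : forall l, C l.2 -> (l \in w1) = (l \in w2).

(** [T] is kept on [C]. Outside [C], all positive defaults are applied except against a denial in
    [w1], so a positive conclusion always wins over a negative default. The least such set is
    founded by construction. *)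
Inductive extend_stable (T : pred letter) : letter -> Prop :=
| ExtendIn y : C y -> T y -> extend_stable T y
| ExtendLit y : ~~ C y -> (true, y) \in w1 -> extend_stable T y
| ExtendFree y : ~~ C y -> (false, y) \notin w1 -> (None, (true, y)) \in ds ->
    extend_stable T y
| ExtendStep x y : ~~ C y -> (false, y) \notin w1 -> (Some x, (true, y)) \in ds ->
    extend_stable T x -> extend_stable T y.

Lemma extend_stable_in T y : C y -> `[< extend_stable T y >] = T y.
Proof.
move=> Cy; apply/asboolP/idP => [ex|Ty]; last exact: ExtendIn.
by case: ex Cy => // [z|z|x z] /negP.
Qed.

Lemma extend_stable_on T o : on C o ->
  on (fun y => `[< extend_stable T y >]) o = on T o.
Proof.
by case: o => [a|] //; rewrite /on /= !andbT => /extend_stable_in ->.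
Qed.

Lemma extend_stable_neg T y : C y ->
  neg_support ds w1 (fun y => `[< extend_stable T y >]) y = neg_support ds w2 T y.
Proof.
move=> Cy; congr (_ || _); first exact: w12.
apply: eq_in_has => d dD; case: eqP => //= e.
by apply: extend_stable_on; apply: C_closed => //; rewrite e.
Qed.

Lemma extend_stable_holds T l : C l.2 ->
  holds ds w1 (fun y => `[< extend_stable T y >]) l = holds ds w2 T l.
Proof.
by move=> Cl; rewrite /holds extend_stable_in // extend_stable_neg.
Qed.

Lemma extend_stableP T : stable ds w2 T ->
  stable ds w1 (fun y => `[< extend_stable T y >]).
Proof.
case=> st1 st2 st3 st4; split.
- move=> y yw; apply/asboolP; case: (boolP (C y)) => Cy; last exact: ExtendLit.
  by apply: ExtendIn => //; apply: st1; rewrite -w12.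
- move=> y /asboolP [{}y Cy /st2|{}y _ /w1_cons|{}y _ yw _|x {}y _ yw _ _] //.
  by rewrite -w12.
- move=> [o [b y]] dD; apply/implyP => /andP [/= od]; case: b dD => // dD _.
  case: (boolP (C y)) => Cy.
    have Co := C_closed dD Cy.
    have := st3 _ dD; rewrite /closed_at /= -(extend_stable_on _ Co) od /=.
    by rewrite extend_stable_in // extend_stable_neg.
  case: (boolP ((false, y) \in w1)) => yw; first by rewrite /neg_support yw orbT.
  apply/orP; left; apply/asboolP.
  case: o od dD => [x|] od dD; last exact: ExtendFree.
  by move: od; rewrite /on /= andbT => /asboolP; apply: ExtendStep.
- move=> U unfU y /asboolP ey.
  elim: ey (ey) => {y} [y Cy Ty|y Cy yw|y Cy yw dD|x y Cy yw dD ex IHx] /asboolP ey;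
    apply/negP => Uy; move: (unfU _ ey Uy) => /andP [zw /allP zd].
  (* Inside [C] foundedness comes from [T], since [C] contains the prerequisites of its conclusions;
     the other cases use the derivation. *)
  + have /st4 : forall z, T z -> (C z && U z) -> unfounded_at ds w2 T (fun z => C z && U z) z.
      move=> z Tz /andP [Cz Uz].
      have /unfU /(_ Uz) /andP [zw' /allP zd'] : `[< extend_stable T z >].
        by apply/asboolP; apply: ExtendIn.
      rewrite /unfounded_at -w12 // zw' /=; apply/allP => d dD; apply/implyP => /eqP e.
      have := zd' d dD; rewrite e eqxx /=; apply: contra.
      have := C_closed dD; rewrite e => /(_ Cz).
      case: (d.1) => [x|] //; rewrite /on /= !andbT => Cx.
      by rewrite extend_stable_in // Cx.
    by move=> /(_ y Ty); rewrite Cy Uy.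
  + by rewrite yw in zw.
  + by have := zd _ dD; rewrite /= eqxx.
  + have := zd _ dD; rewrite /= eqxx /on /= andbT (IHx ex) andbT => /negP; apply.
    exact/asboolP.
Qed.

End Locality.

(** A stable set for [W2] that refutes [l] is turned by [extend_stable] into one for [W1] with the
    same literals over [C]. *)
Lemma entails_local (D : {fset default}) (W1 W2 : {fset literal}) (C : pred letter) l :
  lit_consistent W1 -> lit_consistent W2 ->
  (forall d, d \in D -> C d.2.2 -> on C d.1) ->
  (forall l, C l.2 -> (l \in W1) = (l \in W2)) ->
  C l.2 -> entails D W1 (lit_formula l) -> entails D W2 (lit_formula l).
Proof.
move=> c1 c2 cC w12 Cl.
rewrite !(@entails_stable D _ D _ (fun _ => erefl) (fun _ => erefl)) // => h T stT.
rewrite -(extend_stable_holds (ds := D) (w1 := W1) _ w12) //.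
by apply: h; apply: extend_stableP stT.
Qed.

Lemma consistent_lits (W : {fset literal}) : consistent W -> lit_consistent W.
Proof.
move=> cW y yt; apply/negP => yf; apply: cW => v hv.
have : sat v (lit_formula (true, y)) by apply: hv; exists (true, y).
have : sat v (lit_formula (false, y)) by apply: hv; exists (false, y).
by rewrite !sat_lit /= => /eqP ->.
Qed.

Lemma lit_consistent_sub (w1 w2 : seq literal) :
  {subset w1 <= w2} -> lit_consistent w2 -> lit_consistent w1.
Proof. by move=> s12 c2 y /s12 /c2; apply: contra; apply: s12. Qed.

Section SmallWitness.

Variables (D : {fset default}) (W : {fset literal}).

Definition ancestor (x : letters D W) (y : letter) : bool :=
  [exists z : letters D W, (val z == y) && connect (@dep_edge D W) z x].

Lemma ancestor_closed x d : d \in D -> ancestor x d.2.2 -> on (ancestor x) d.1.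
Proof.
move=> dD /existsP [z /andP [/eqP zd zx]]; case e : d.1 => [a|] //.
rewrite /on /= andbT.
have aL : a \in letters D W.
  rewrite /letters !inE /=; apply/orP; left; apply/flattenP.
  exists (default_letters d); first by apply: map_f.
  by rewrite /default_letters e !inE eqxx orbT.
apply/existsP; exists [` aL]; rewrite /= eqxx /=.
apply: connect_trans zx; apply: connect1; apply/hasP; exists d => //=.
by rewrite e eqxx zd eqxx.
Qed.

(** Let [x] have fewest ancestors among the letters of [S]. If another letter [z] of [S] is an
    ancestor of [x], its ancestors are among those of [x], so by minimality they coincide and [x] is
    an ancestor of [z]. The literals of [S] over ancestors of [x] thus stay in one component. *)
Lemma small_witness (c : nat) L S :
  consistent W -> tightness D W <= c -> strong_witness D W L S ->
  exists2 S', strong_witness D W L S' & #|` S'| <= c.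
Proof.
move=> /consistent_lits cW tight [S0 SW ent1 ent2].
have SinW l : l \in S -> l \in W by move=> /(fsubsetP SW); rewrite inE => /andP [].
have litL l : l \in W -> l.2 \in letters D W.
  by move=> lW; rewrite /letters !inE /= (map_f snd lW) orbT.
pose P (x : letters D W) := ((true, val x) \in S) || ((false, val x) \in S).
have [x0 Px0] : exists x0, P x0.
  have /fset0Pn [l lS] := S0.
  exists [` litL l (SinW l lS)]; rewrite /P /=.
  by case: l lS => -[] y ->; rewrite ?orbT.
pose anc (x : letters D W) := [set z | connect (@dep_edge D W) z x].
have [x Px minx] := arg_minnP (fun x => #|anc x|) Px0.
pose S' := [fset l in S | ancestor x l.2].
have S'S : S' `<=` S by apply/fsubsetP => l; rewrite !inE => /andP [].
have cons' (V : {fset literal}) : V `<=` W -> lit_consistent V.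
  by move=> /fsubsetP s; apply: lit_consistent_sub cW.
(* Over the ancestors of [x], removing [S] or [S'] is the same. The empty [V] serves the first
   witness condition and [L] the second. *)
have local (V : {fset literal}) l : ancestor x l.2 ->
    (entails D (W `\` (S `|` V)) (lit_formula (lneg l)) <->
     entails D (W `\` (S' `|` V)) (lit_formula (lneg l))).
  move=> al; have agree l' : ancestor x l'.2 ->
      (l' \in W `\` (S `|` V)) = (l' \in W `\` (S' `|` V)).
    by move=> al'; rewrite !inE al' andbT.
  split; apply: (entails_local (C := ancestor x)) => //; try exact: cons' (fsubsetDl _ _);
    try exact: ancestor_closed; by move=> l' al'; rewrite agree.
exists S'.
  split.
  - have [l lS lx] : exists2 l, l \in S & l.2 = val x.
      by case/orP: Px => h; [exists (true, val x)|exists (false, val x)].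
    apply/fset0Pn; exists l; rewrite !inE lS /=; apply/existsP; exists x.
    by rewrite lx eqxx connect0.
  - exact: fsubset_trans S'S SW.
  - move=> l; rewrite !inE => /andP [lS al].
    have := local fset0 l al; rewrite !fsetU0 => -[h _]; apply: h.
    exact: ent1.
  - by move=> l; rewrite !inE => /andP [lS al] /(local L l al); apply: ent2.
apply: leq_trans tight; apply: leq_trans (leq_bigmax x).
have -> : #|` S'| = size [seq l.2 | l <- S'] by rewrite size_map.
rewrite cardE -(size_map val); apply: uniq_leq_size.
  (* As [W] is consistent, distinct literals of [S'] have distinct letters, so counting letters
     suffices. *)
  rewrite map_inj_in_uniq ?fset_uniq // => -[b y] [b' y'] h h' /= e.
  rewrite e in h *; congr pair.
  have {}h := SinW _ (fsubsetP S'S _ h); have {}h' := SinW _ (fsubsetP S'S _ h').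
  by case: b b' h h' => -[] // h h'; [have := cW _ h | have := cW _ h'];
    rewrite ?h ?h'.
move=> _ /mapP [l lS' ->]; move: lS'; rewrite !inE => /andP [lS /existsP [z /andP [/eqP zl zx]]].
rewrite -zl map_f // mem_enum inE zx andbT.
have Pz : P z by rewrite /P zl; case: l {zl} lS => -[] y ->; rewrite ?orbT.
have sub : anc z \subset anc x.
  by apply/subsetP => t; rewrite !inE => tz; apply: connect_trans tz zx.
have e : anc z = anc x by apply/eqP; rewrite eqEcard sub minx.
have : x \in anc x by rewrite inE connect0.
by rewrite -e inE.
Qed.

End SmallWitness.

(** * The algorithm *)

Section Enumeration.

Variables (ds : seq default) (ws : seq literal).

Definition witnessb (L S : seq literal) : bool :=
  [&& ~~ nilp S, all (fun l => l \notin L) S,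
      all (fun l => entailsb ds [seq x <- ws | x \notin S] (lneg l)) S
    & all (fun l => ~~ entailsb ds [seq x <- ws | (x \notin S) && (x \notin L)] (lneg l)) S].

(** Words may permute or repeat literals; each is replaced by the sublist of [ws] with the same
    elements, so that [dedup] leaves one list per set. *)
Definition outliers (c k : nat) : seq (seq literal) :=
  dedup [seq [seq x <- ws | x \in L]
        | L <- [seq L <- words k ws | has (witnessb L) (words c ws)]].

Variables (D : {fset default}) (W : {fset literal}).
Hypothesis dsD : ds =i D.
Hypothesis wsW : ws =i W.
Hypothesis W_cons : consistent W.

Lemma entails_entailsb (V : {fset literal}) (w : seq literal) l :
  V `<=` W -> w =i V -> entails D V (lit_formula l) <-> entailsb ds w l.
Proof.
move=> /fsubsetP VW wV; have cw : lit_consistent w.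
  apply: lit_consistent_sub (consistent_lits W_cons) => x.
  by rewrite wV; apply: VW.
rewrite (entails_stable dsD wV cw); split; first by move/entailsbP.
by move/entailsbP.
Qed.

Lemma witnessbP (L S : {fset literal}) (r s : seq literal) :
  r =i L -> s =i S -> {subset s <= ws} ->
  reflect (strong_witness D W L S) (witnessb r s).
Proof.
move=> rL sS sws.
have e1 l : entails D (W `\` S) (lit_formula l) <->
    entailsb ds [seq x <- ws | x \notin s] l.
  apply: entails_entailsb; first exact: fsubsetDl.
  by move=> x; rewrite mem_filter !inE wsW sS.
have e2 l : entails D (W `\` (S `|` L)) (lit_formula l) <->
    entailsb ds [seq x <- ws | (x \notin s) && (x \notin r)] l.
  apply: entails_entailsb; first exact: fsubsetDl.
  by move=> x; rewrite mem_filter !inE negb_or wsW sS rL.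
apply: (iffP and4P) => [[h1 /allP h2 /allP h3 /allP h4]|[h1 h2 h3 h4]]; split.
- case: s h1 sS {sws e1 e2 h2 h3 h4} => // x s _ /(_ x); rewrite inE eqxx => xS.
  by apply/fset0Pn; exists x.
- apply/fsubsetP => x; rewrite -sS => xs; rewrite inE -wsW sws // andbT -rL.
  exact: h2.
- by move=> l; rewrite -sS => /h3 /e1.
- by move=> l; rewrite -sS => /h4 /negP h /e2.
- by have /fset0Pn [x] := h1; rewrite -sS; case: (s).
- apply/allP => x; rewrite sS => /(fsubsetP h2); rewrite inE rL.
  by move=> /andP [].
- by apply/allP => x; rewrite sS => /h3 /e1.
- by apply/allP => x; rewrite sS => /h4 h; apply/negP => /e2.
Qed.

Lemma outliers_enumerates (c k : nat) :
  uniq ws -> tightness D W <= c ->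
  enumerates (fun L => strong_outlier_set D W L /\ #|` L| <= k) (outliers c k).
Proof.
move=> uws tight; have [uout out_mem] := dedupP
  [seq [seq x <- ws | x \in L] | L <- [seq L <- words k ws | has (witnessb L) (words c ws)]].
rewrite -/(outliers c k) in uout out_mem.
have fsetE (L : seq literal) : [fset x in L] =i L by move=> x; rewrite inE.
have canon l : l \in outliers c k -> l = [seq x <- ws | x \in l].
  rewrite out_mem => /mapP [L _ ->]; apply: eq_in_filter => x xws.
  by rewrite mem_filter xws andbT.
exists [seq [fset x in l] | l <- outliers c k]; split.
- rewrite map_inj_in_uniq // => l1 l2 /canon e1 /canon e2 /fsetP e.
  rewrite e1 e2; apply: eq_filter => x.
  by have := e x; rewrite !inE.
- move=> L; split.
    move=> /mapP [l]; rewrite out_mem => /mapP [r].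
    rewrite mem_filter mem_words => /andP [/hasP [s]].
    rewrite mem_words => /andP [_ /allP sws] wit /andP [szr /allP rws] -> ->.
    have rL : r =i [fset x in [seq x <- ws | x \in r]].
      move=> x; rewrite inE mem_filter.
      by case: (boolP (x \in r)) => // /rws.
    split.
      split; first by apply/fsubsetP => x; rewrite -rL => /rws; rewrite -wsW.
      exists [fset x in s]; apply: (@witnessbP _ _ r s) => // x.
      by rewrite inE.
    apply: leq_trans szr; apply: uniq_leq_size; first exact: fset_uniq.
    by move=> x xL; rewrite rL.
  move=> [[LW [S0 wit0]] szL].
  have [S wit szS] := small_witness W_cons tight wit0.
  have Lws : {subset L <= ws} by move=> x /(fsubsetP LW); rewrite wsW.
  have Sws : {subset S <= ws}.
    move=> x; case: wit => _ /fsubsetP SW _ _ /SW; rewrite inE wsW.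
    by move=> /andP [].
  apply/mapP; exists [seq x <- ws | x \in L]; last first.
    apply/fsetP => x; rewrite inE mem_filter.
    by case: (boolP (x \in L)) => // /Lws.
  (* The duplicate-free lists of elements of [L] and [S] have at most [k] and [c] entries, so they
     are among the words tried. *)
  rewrite out_mem; apply/mapP; exists (L : seq literal) => //.
  rewrite mem_filter mem_words szL /= andbC; apply/andP; split; first exact/allP.
  apply/hasP; exists (S : seq literal).
    by rewrite mem_words szS /=; apply/allP.
  by apply/(@witnessbP L S) => // x; apply: Sws.
- have : all (fun l => perm_eq l [fset x in l]) (outliers c k).
    apply/allP => l /canon e; apply: uniq_perm; last by move=> x; rewrite inE.
      by rewrite e filter_uniq.
    exact: fset_uniq.
  by elim: (outliers c k) => //= l r IHr /andP [-> /IHr].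
Qed.

End Enumeration.

(** * Running time of the algorithm *)

Lemma poly_eq_letter : poly_eq letter.
Proof. exact: poly_eq_seq poly_eq_bool. Qed.

Lemma poly_eq_literal : poly_eq literal.
Proof. exact: poly_eq_pair poly_eq_bool poly_eq_letter. Qed.

Lemma poly_eq_prereq : poly_eq (option letter).
Proof. exact: poly_eq_option poly_eq_letter. Qed.

Lemma poly_comp2 (G A B C : Type) (eG : Enc G) (eA : Enc A) (eB : Enc B)
    (eC : Enc C) (f : A -> B -> C) (a : G -> A) (b : G -> B) :
  poly_time (fun p : A * B => f p.1 p.2) -> poly_time a -> poly_time b ->
  poly_time (fun g => f (a g) (b g)).
Proof.
by move=> pf pa pb; apply: (poly_comp (f := fun g => (a g, b g)) pf); apply: poly_pair.
Qed.

Lemma poly_some (G A : Type) (eG : Enc G) (eA : Enc A) (a : G -> A) :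
  poly_time a -> poly_time (fun g => Some (a g)).
Proof.
(* [Some x] and [(x, tt)] have the same code. *)
move=> pa; have pS : poly_time (fun p : A * unit => Some p.1).
  by apply: poly_recode; case=> x [].
apply: (poly_comp (f := fun g => (a g, tt)) pS).
by apply: poly_pair => //; apply: poly_const.
Qed.

(** Decomposes the body by its head operation, with second-order patterns reading the arguments as
    functions of the context. Hypotheses on abstract functions come after the known operations;
    [poly_tac] falls back on constants. *)
Ltac poly_step :=
  cbv beta;
  lazymatch goal with
  | |- poly_eq _ => first
      [ exact poly_eq_letter | exact poly_eq_literal | exact poly_eq_prereq
      | apply poly_eq_seq ]
  | |- @poly_time _ _ _ _ (fun g => g) => apply poly_id
  | |- @poly_time _ _ _ _ (@fst _ _) => apply poly_fst
  | |- @poly_time _ _ _ _ (@snd _ _) => apply poly_snd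
  | |- @poly_time _ _ _ _ (fun g => (@?f g).1) => apply (@poly_fst_of _ _ _ _ _ _ f)
  | |- @poly_time _ _ _ _ (fun g => (@?f g).2) => apply (@poly_snd_of _ _ _ _ _ _ f)
  | |- @poly_time _ _ _ _ (fun g => Some (@?a g)) => apply (@poly_some _ _ _ _ a)
  | |- @poly_time _ _ _ _ (fun g => (@?a g, @?b g)) => apply (@poly_pair _ _ _ _ _ _ a b)
  | |- @poly_time _ _ _ _ (fun g => @?a g :: @?b g) => apply (@poly_cons _ _ _ _ a b)
  | |- @poly_time _ _ _ _ (fun g => @?a g ++ @?b g) => apply (@poly_cat _ _ _ _ a b)
  | |- @poly_time _ _ _ _ (fun g => flatten (@?a g)) => apply (@poly_flatten _ _ _ _ a)
  | |- @poly_time _ _ _ _ (fun g => ~~ (@?a g)) => apply (@poly_negb _ _ a)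
  | |- @poly_time _ _ _ _ (fun g => nilp (@?a g)) => apply (@poly_nilp _ _ _ _ a)
  | |- @poly_time _ _ _ _ (fun g => @?a g && @?b g) => apply (@poly_andb _ _ a b)
  | |- @poly_time _ _ _ _ (fun g => @?a g || @?b g) => apply (@poly_orb _ _ a b)
  | |- @poly_time _ _ _ _ (fun g => @?a g ==> @?b g) => apply (@poly_implb _ _ a b)
  | |- @poly_time _ _ _ _ (fun g => @?a g == @?b g) => apply (@poly_eq_of _ _ _ _ a b)
  | |- @poly_time _ _ _ _ (fun g => in_mem (@?a g) (mem (@?b g))) =>
      apply (@poly_mem _ _ _ _ a b)
  | |- @poly_time _ _ _ _ (fun g => has (fun x => @?P g x) (@?s g)) =>
      apply (@poly_has _ _ _ _ P s)
  | |- @poly_time _ _ _ _ (fun g => all (fun x => @?P g x) (@?s g)) =>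
      apply (@poly_all _ _ _ _ P s)
  | |- @poly_time _ _ _ _ (fun g => filter (fun x => @?P g x) (@?s g)) =>
      apply (@poly_filter _ _ _ _ P s)
  | |- @poly_time _ _ _ _ (fun g => map (fun x => @?P g x) (@?s g)) =>
      apply (@poly_map _ _ _ _ _ _ P s)
  | |- @poly_time _ _ _ _ (fun g => shrink (fun X x => @?P g X x) (@?s g)) =>
      apply (@poly_shrink _ _ _ _ P s)
  | |- @poly_time _ _ _ _ (fun g => dedup (@?a g)) => apply (@poly_dedup _ _ _ _ a)
  | H : @poly_time _ _ _ _ ?f |- @poly_time _ _ _ _ ?f => exact H
  | H : @poly_time _ _ _ _ ?f |- @poly_time _ _ _ _ (fun g => ?f (@?a g)) =>
      apply (@poly_comp _ _ _ _ _ _ f a H)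
  | H : poly_time (fun p => ?f p.1 p.2)
    |- @poly_time _ _ _ _ (fun g => ?f (@?a g) (@?b g)) =>
      apply (@poly_comp2 _ _ _ _ _ _ _ _ f a b H)
  end.

Ltac poly_tac := repeat first [poly_step | simple apply poly_const].

(** A set of letters is not encoded data here: it enters through a membership test, polynomial in
    the context and the letter. *)
Lemma poly_on (G : Type) (eG : Enc G) (T : G -> pred letter) (o : G -> option letter) :
  poly_time (fun p : G * letter => T p.1 p.2) -> poly_time o ->
  poly_time (fun g => on (T g) (o g)).
Proof.
move=> pT po; apply: (poly_all (P := T)) => //.
exact: poly_comp (poly_seq_of_opt _) po.
Qed.

Lemma poly_neg_support (G : Type) (eG : Enc G) (ds : G -> seq default)
    (w : G -> seq literal) (T : G -> pred letter) (y : G -> letter) :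
  poly_time ds -> poly_time w -> poly_time (fun p : G * letter => T p.1 p.2) ->
  poly_time y -> poly_time (fun g => neg_support (ds g) (w g) (T g) (y g)).
Proof.
move=> pds pw pT py; rewrite /neg_support; poly_tac.
by apply: (poly_on (T := fun p => T p.1)); poly_tac.
Qed.

Lemma poly_unfounded_at (G : Type) (eG : Enc G) (ds : G -> seq default)
    (w : G -> seq literal) (T U : G -> pred letter) (y : G -> letter) :
  poly_time ds -> poly_time w -> poly_time (fun p : G * letter => T p.1 p.2) ->
  poly_time (fun p : G * letter => U p.1 p.2) -> poly_time y ->
  poly_time (fun g => unfounded_at (ds g) (w g) (T g) (U g) (y g)).
Proof.
move=> pds pw pT pU py; rewrite /unfounded_at; poly_tac.
by apply: (poly_on (T := fun p x => T p.1 x && ~~ U p.1 x)); poly_tac.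
Qed.

Lemma poly_closed_at (G : Type) (eG : Enc G) (ds : G -> seq default)
    (w : G -> seq literal) (T : G -> pred letter) (d : G -> default) :
  poly_time ds -> poly_time w -> poly_time (fun p : G * letter => T p.1 p.2) ->
  poly_time d -> poly_time (fun g => closed_at (ds g) (w g) (T g) (d g)).
Proof.
move=> pds pw pT pd; rewrite /closed_at; poly_tac.
  by apply: poly_on; poly_tac.
by apply: poly_neg_support; poly_tac.
Qed.

Lemma poly_unfounded_part (G : Type) (eG : Enc G) (ds : G -> seq default)
    (w : G -> seq literal) (X : G -> seq letter) :
  poly_time ds -> poly_time w -> poly_time X ->
  poly_time (fun g => unfounded_part (ds g) (w g) (X g)).
Proof.
move=> pds pw pX; rewrite /unfounded_part; poly_tac.
by apply: (poly_unfounded_at (T := fun p x => x \in X p.1.1)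
  (U := fun p x => x \in p.1.2)); poly_tac.
Qed.

Lemma poly_largest_avoiding (G : Type) (eG : Enc G) (ds : G -> seq default)
    (w : G -> seq literal) (A : G -> seq letter) :
  poly_time ds -> poly_time w -> poly_time A ->
  poly_time (fun g => largest_avoiding (ds g) (w g) (A g)).
Proof.
move=> pds pw pA.
apply: (poly_shrink (P := fun g X y => stay_at (ds g) (w g) (A g) X y)); last first.
  by rewrite /head_letters; poly_tac.
rewrite /stay_at; poly_tac.
  by apply: poly_unfounded_part; poly_tac.
by apply: (@poly_closed_at _ _ (fun p => ds p.1.1.1) (fun p => w p.1.1.1)
  (fun p x => x \in p.1.1.2) (fun p => p.2)); poly_tac.
Qed.

Lemma poly_avoidable (G : Type) (eG : Enc G) (ds : G -> seq default)
    (w : G -> seq literal) (A : G -> seq letter) :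
  poly_time ds -> poly_time w -> poly_time A ->
  poly_time (fun g => avoidable (ds g) (w g) (A g)).
Proof.
move=> pds pw pA; have pL := poly_largest_avoiding pds pw pA.
rewrite /avoidable; apply: poly_andb.
  apply: (poly_all (P := fun g l => l.1 ==> (l.2 \in largest_avoiding (ds g) (w g) (A g)))) => //.
  poly_tac; exact: poly_comp pL (poly_fst _ _).
apply: (poly_all (P := fun g d => closed_at (ds g) (w g) (fun x => x \in
  largest_avoiding (ds g) (w g) (A g)) d)) => //.
apply: (@poly_closed_at _ _ (fun p => ds p.1) (fun p => w p.1)
  (fun p x => x \in largest_avoiding (ds p.1) (w p.1) (A p.1)) (fun p => p.2)); poly_tac.
exact: poly_comp pL (poly_fst_of (poly_fst _ _)).
Qed.

Lemma poly_entailsb (G : Type) (eG : Enc G) (ds : G -> seq default)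
    (w : G -> seq literal) (l : G -> literal) :
  poly_time ds -> poly_time w -> poly_time l ->
  poly_time (fun g => entailsb (ds g) (w g) (l g)).
Proof.
move=> pds pw pl; rewrite /entailsb; apply: poly_if; poly_tac.
- by apply: poly_avoidable; poly_tac.
- by apply: poly_avoidable; poly_tac.
- by apply: poly_largest_avoiding; poly_tac.
apply: poly_avoidable => //; rewrite /neg_prereqs; poly_tac.
exact: poly_comp (poly_seq_of_opt _) (poly_fst_of (poly_snd _ _)).
Qed.

Lemma poly_witnessb (G : Type) (eG : Enc G) (ds : G -> seq default)
    (ws L S : G -> seq literal) :
  poly_time ds -> poly_time ws -> poly_time L -> poly_time S ->
  poly_time (fun g => witnessb (ds g) (ws g) (L g) (S g)).
Proof.
move=> pds pws pL pS; rewrite /witnessb /lneg.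
by poly_tac; apply: poly_entailsb; poly_tac.
Qed.

Lemma poly_outliers (c k : nat) :
  poly_time (fun p : seq default * seq literal => outliers p.1 p.2 c k).
Proof.
rewrite /outliers; poly_tac.
- apply: (poly_has (P := fun q S => witnessb q.1.1 q.1.2 q.2 S)).
    by apply: poly_witnessb; poly_tac.
  exact: poly_comp (poly_words _ _) (poly_snd_of (poly_fst _ _)).
- exact: poly_comp (poly_words _ _) (poly_snd _ _).
Qed.

Theorem mainTheorem8 (c k : nat) (hc : 0 < c) (hk : 0 < k) :
  exists (p : cmd) (q : {poly nat}),
    forall (D : {fset default}) (W : {fset literal})
           (ds : seq default) (ws : seq literal),
      consistent W -> tightness D W <= c ->
      perm_eq ds D -> perm_eq ws W ->
      exists (out : seq (seq literal)) (t : nat),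
        [/\ computes p (enc_theory ds ws) (enc_literal_sets out) t,
            t <= (q.[tree_size (enc_theory ds ws)])%R &
            enumerates (fun L => strong_outlier_set D W L /\ #|` L| <= k) out].
Proof.
have [p [N [q pq]]] := poly_outliers c k; exists p, q => D W ds ws cW tight dsD wsW.
(* The code of the pair [(ds, ws)] unfolds to [enc_theory ds ws]. *)
have [|s [t [ex s0 _ tq]]] := pq (upd (fun=> Leaf) 0 (enc_theory ds ws)) (ds, ws) => //.
exists (outliers ds ws c k), t; split=> //; first by exists s.
apply: outliers_enumerates => //; first exact: perm_mem.
  exact: perm_mem.
by rewrite (perm_uniq wsW) fset_uniq.
Qed.
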